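(* Let $0<\alpha\le 1$, let $c$ be a complex number with $\Re c>0$, and let $n$ be a positive integer. Put $t=\arg c\in(-\frac\pi2,\frac\pi2)$ and $A=\frac2n|c|^\alpha\sin\frac{\pi\alpha}{2}\cos t$, and let $\Omega=\Omega_1\cup\Omega_2\cup\Omega_3$, where $$\Omega_1=\{w\in\mathbb{C}:\Re w<0\},$$ $$\Omega_2=\left\{w\in\mathbb{C}:\left|\Im w+n\alpha\tan t\right|<\frac{n}{2\cos t}\left(\frac{\alpha-1}{\sqrt{1+A}}+(\alpha+1)\sqrt{1+A}\right)\right\},$$ $$\Omega_3=\{w\in\mathbb{C}:|\arg w|<\pi\alpha/2\}.$$ If a function $q\in\mathcal{H}[c^\alpha,n]$ satisfies the condition $$q(z)+\frac{zq'(z)}{q(z)}\in\Omega\quad\text{for all } z\in\mathbb{D},$$ then $|\arg q(z)|<\pi\alpha/2$ for all $z\in\mathbb{D}$.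
   Context: $\mathbb{D}=\{z\in\mathbb{C}:|z|<1\}$. For $a\in\mathbb{C}$ and a positive integer $n$, $\mathcal{H}[a,n]$ is the set of holomorphic functions $h$ on $\mathbb{D}$ of the form $h(z)=a+c_nz^n+c_{n+1}z^{n+1}+\cdots$. The power $c^\alpha$ is the principal one. $\arg$ is the principal argument, and a condition on $\arg w$ includes $w\neq 0$. The condition on $q(z)+zq'(z)/q(z)$ is understood to include that $q(z)\ne0$ on $\mathbb{D}$. *)

(* Defs.v *)
From Stdlib Require Import Reals Lra Psatz.
From Coquelicot Require Import Coquelicot.
Open Scope R_scope.

Definition disk (z : C) : Prop := Cmod z < 1.

(* C_AbsRing / C_NormedModule are given explicitly so that differentiability
   and summation are over C, not over R. *)
Definition holomorphic_on_disk (h : C -> C) : Prop :=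
  forall z : C, disk z -> @ex_derive C_AbsRing C_NormedModule h z.

(* H[a,n] for n >= 1.  The values of h outside the disk are irrelevant, and
   the coefficient b n may vanish. *)
Definition Hclass (a : C) (n : nat) (h : C -> C) : Prop :=
  holomorphic_on_disk h /\
  exists b : nat -> C,
    b 0%nat = a /\
    (forall k : nat, (0 < k < n)%nat -> b k = 0%C) /\
    forall z : C, disk z -> @is_pseries C_AbsRing C_NormedModule b z (h z).

(* Principal argument, in (-PI, PI]; the value at 0 is meaningless. *)
Definition Carg (z : C) : R :=
  if Rle_dec 0 (Im z) then acos (Re z / Cmod z) else - acos (Re z / Cmod z).

(* exp (alpha * Log c) for c <> 0; the value at c = 0 is meaningless. *)
Definition Cpower (c : C) (alpha : R) : C :=
  (RtoC (Rpower (Cmod c) alpha) *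
   (cos (alpha * Carg c), sin (alpha * Carg c)))%C.

Lemma Carg_spec (z : C) (theta : R) : z <> 0%C ->
  (Carg z = theta <->
   - PI < theta <= PI /\ z = (RtoC (Cmod z) * (cos theta, sin theta))%C).
Proof.
intros Hz.
pose proof (proj1 (Cmod_gt_0 z) Hz) as Hm.
assert (H2 : Cmod z ^ 2 = Re z ^ 2 + Im z ^ 2) by apply Cmod2_alt.
set (u := Re z / Cmod z).
assert (Hu : Re z = Cmod z * u) by (unfold u; field; lra).
assert (Hu1 : -1 <= u <= 1).
{ assert (Hle : Rabs (Re z) <= Cmod z) by apply re_le_Cmod.
  apply Rabs_le_between in Hle.
  split; apply (Rmult_le_reg_l (Cmod z)); lra. }
pose proof PI_RGT_0 as HPI.
split.
- intros <-. unfold Carg; fold u.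
  assert (Hs : Cmod z * sqrt (1 - u²) = Rabs (Im z)).
  { rewrite <- (sqrt_Rsqr (Cmod z)) at 1 by lra.
    rewrite <- sqrt_mult_alt by apply Rle_0_sqr.
    rewrite <- sqrt_Rsqr_abs. f_equal. unfold Rsqr. nra. }
  pose proof (acos_bound u) as Hb.
  destruct (Rle_dec 0 (Im z)) as [Hi | Hi].
  + split; [lra |].
    rewrite cos_acos, sin_acos by lra.
    rewrite Rabs_pos_eq in Hs by lra.
    destruct z as [x y]; cbn [Re Im fst snd] in *.
    unfold Cmult, RtoC; cbn [fst snd]; f_equal; lra.
  + assert (acos u <> PI).
    { intros He.
      assert (Hc : u = -1) by (rewrite <- (cos_acos u), He by lra; apply cos_PI).
      rewrite Hc in Hu. nra. }
    split; [lra |].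
    rewrite cos_neg, sin_neg, cos_acos, sin_acos by lra.
    rewrite Rabs_left in Hs by lra.
    destruct z as [x y]; cbn [Re Im fst snd] in *.
    unfold Cmult, RtoC; cbn [fst snd]; f_equal; lra.
- intros [Ht E]. unfold Carg; fold u.
  assert (Er : Re z = Cmod z * cos theta).
  { rewrite E at 1. unfold Re, Cmult, RtoC; cbn [fst snd]; ring. }
  assert (Ei : Im z = Cmod z * sin theta).
  { rewrite E at 1. unfold Im, Cmult, RtoC; cbn [fst snd]; ring. }
  assert (Hc : u = cos theta) by (apply (Rmult_eq_reg_l (Cmod z)); lra).
  rewrite Hc, Ei.
  destruct (Rle_dec 0 (Cmod z * sin theta)) as [Hi | Hi].
  + apply acos_cos. split; [| lra].
    destruct (Rle_lt_dec 0 theta) as [|Hn]; [assumption |].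
    pose proof (sin_lt_0_var theta ltac:(lra) Hn). nra.
  + rewrite <- cos_neg, acos_cos; [ring |].
    split; [| lra].
    destruct (Rle_lt_dec theta 0) as [|Hn]; [lra |].
    pose proof (sin_ge_0 theta ltac:(lra) ltac:(lra)). nra.
Qed.

Definition sector (alpha : R) (w : C) : Prop :=
  w <> 0%C /\ Rabs (Carg w) < PI * alpha / 2.

Definition Omega1 (w : C) : Prop := Re w < 0.

Definition Omega2 (n : nat) (alpha t A : R) (w : C) : Prop :=
  Rabs (Im w + INR n * alpha * tan t) <
  INR n / (2 * cos t) *
  ((alpha - 1) / sqrt (1 + A) + (alpha + 1) * sqrt (1 + A)).

Definition Omega3 (alpha : R) (w : C) : Prop := sector alpha w.

Definition Omega (n : nat) (alpha t A : R) (w : C) : Prop :=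
  Omega1 w \/ Omega2 n alpha t A w \/ Omega3 alpha w.

(* Main.v *)
(** Write [q = p^alpha] with [p 0 = c].  If [q] leaves the sector, take a point [z0] of least
    modulus where it does; then [p z0 = i sigma s] lies on the imaginary axis while [Re p > 0] for
    [|z| < |z0|].  The Cayley transform [(p - c) / (p + conj c)] maps that disk to the unit disk
    and vanishes to order [n] at 0, so by the Schwarz lemma and its boundary version (Jack's
    lemma) its logarithmic derivative at [z0], times [z0], is real and at least [n].  Hence
    [z0 q'(z0) / q(z0) = i sigma k] with [k >= n alpha |p(z0) - c|^2 / (2 s Re c)], and elementary
    estimates show that [q(z0) + z0 q'(z0) / q(z0)] avoids all three regions.

    The maximum principle behind the Schwarz lemma is proved without Cauchy's theorem, from
    second-order complex Taylor expansions; those come from dividing power series by [w - z]. *)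

Require Import Defs.
From Stdlib Require Import Reals Lra Psatz Lia ClassicalEpsilon.
From Coquelicot Require Import Coquelicot.
Open Scope R_scope.

(** * Continuity and second-order expansions of complex functions *)

(** Only [q] comes with a power series. The function fed to the Schwarz argument is built from [q]
    by a logarithm, an exponential and a fraction, and expanding it would require composing and
    inverting power series. The proof carries a pointwise relation [jet2] instead, closed under
    products, composition and local inversion. Second order is what the maximum principle requires:
    the four-point mean gains a multiple of s^2, so the remainder must be o(s^2).

    At the exit point, bounds are available only from inside the disk |z| < |z0|, yet a derivative
    is needed at z0 itself. Hence the root is taken on the whole slit plane rather than on the
    sector: since alpha <= 1 and q(z0) <> 0, the edge value q(z0) lies inside the slit plane, and
    the expansion exists there too.

    The term added at z0 is purely imaginary and has the sign of Im q(z0). It leaves the real part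
    nonnegative, moves the value out across the edge of the sector, and is large enough to clear the
    strip, whose half-width is a lower bound over all positions of p(z0) on the imaginary axis. *)

Notation Ccont := (@continuous C_UniformSpace C_UniformSpace).
Notation Rcont := (@continuous C_UniformSpace R_UniformSpace).
Notation near z P := (@locally C_UniformSpace z P).

Ltac eqR := match goal with |- @eq _ ?a ?b => change (@eq R a b) end.
Ltac eqC := cbv beta; change (UniformSpace.sort C_UniformSpace) with C in *; match goal with |- @eq _ ?a ?b => change (@eq C a b) end.
Ltac Cring := eqC; ring.
Ltac Cfield := eqC; field.

Lemma near_Cmod (z : C) (P : C -> Prop) :
  near z P <-> exists d : posreal, forall w : C, Cmod (w - z) < d -> P w.
Proof.
rewrite locally_C. split; intros [d Hd]; exists d; intros w Hw; apply Hd; exact Hw.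
Qed.

Lemma Ccont_pair (f g : C -> R) (z : C) :
  Rcont f z -> Rcont g z -> Ccont (fun w => (f w, g w)) z.
Proof.
intros Hf Hg P [d Hd].
specialize (Hf (ball (f z) d) (locally_ball _ d)).
specialize (Hg (ball (g z) d) (locally_ball _ d)).
unfold filtermap in *.
generalize (filter_and _ _ Hf Hg). apply filter_imp.
intros w [H1 H2]. apply Hd. split; assumption.
Qed.

Lemma Rcont_Re (f : C -> C) (z : C) : Ccont f z -> Rcont (fun w => Re (f w)) z.
Proof.
intros Hf. apply (continuous_comp (U:=C_UniformSpace) (V:=C_UniformSpace) f fst); [exact Hf |].
apply (continuous_fst (U:=R_UniformSpace) (V:=R_UniformSpace)).
Qed.

Lemma Rcont_Im (f : C -> C) (z : C) : Ccont f z -> Rcont (fun w => Im (f w)) z.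
Proof.
intros Hf. apply (continuous_comp (U:=C_UniformSpace) (V:=C_UniformSpace) f snd); [exact Hf |].
apply (continuous_snd (U:=R_UniformSpace) (V:=R_UniformSpace)).
Qed.

Lemma Ccont_id (z : C) : Ccont (fun w => w) z.
Proof. apply (@continuous_id C_UniformSpace). Qed.

Lemma Ccont_const (a z : C) : Ccont (fun _ => a) z.
Proof. apply (@continuous_const C_UniformSpace C_UniformSpace). Qed.

Lemma Ccont_plus (f g : C -> C) (z : C) :
  Ccont f z -> Ccont g z -> Ccont (fun w => (f w + g w)%C) z.
Proof.
intros Hf Hg. apply Ccont_pair.
- apply (continuous_plus (V:=R_NormedModule)); [exact (Rcont_Re f z Hf) | exact (Rcont_Re g z Hg)].
- apply (continuous_plus (V:=R_NormedModule)); [exact (Rcont_Im f z Hf) | exact (Rcont_Im g z Hg)].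
Qed.

Lemma Ccont_mult (f g : C -> C) (z : C) :
  Ccont f z -> Ccont g z -> Ccont (fun w => (f w * g w)%C) z.
Proof.
intros Hf Hg.
pose proof (Rcont_Re f z Hf) as F1. pose proof (Rcont_Im f z Hf) as F2.
pose proof (Rcont_Re g z Hg) as G1. pose proof (Rcont_Im g z Hg) as G2.
apply Ccont_pair.
- apply (continuous_minus (V:=R_NormedModule));
    apply (continuous_mult (K:=R_AbsRing)); assumption.
- apply (continuous_plus (V:=R_NormedModule));
    apply (continuous_mult (K:=R_AbsRing)); assumption.
Qed.

Lemma Ccont_minus (f g : C -> C) (z : C) :
  Ccont f z -> Ccont g z -> Ccont (fun w => (f w - g w)%C) z.
Proof.
intros Hf Hg.
apply (continuous_ext (fun w => (f w + (-1) * g w)%C)).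
{ intros w. eqC. ring. }
apply Ccont_plus; [exact Hf |]. apply Ccont_mult; [apply Ccont_const | exact Hg].
Qed.

Lemma Rcont_Cmod (f : C -> C) (z : C) : Ccont f z -> Rcont (fun w => Cmod (f w)) z.
Proof.
intros Hf.
apply (continuous_comp (V:=R_UniformSpace) (fun w => fst (f w) ^ 2 + snd (f w) ^ 2) sqrt);
  [| apply continuous_sqrt].
apply (continuous_ext (fun w => Re (f w) * Re (f w) + Im (f w) * Im (f w))).
{ intros w. eqR. unfold Re, Im. ring. }
pose proof (Rcont_Re f z Hf) as F1. pose proof (Rcont_Im f z Hf) as F2.
apply (continuous_plus (V:=R_NormedModule));
    apply (continuous_mult (K:=R_AbsRing)); assumption.
Qed.

Lemma Ccont_inv (f : C -> C) (z : C) :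
  Ccont f z -> f z <> 0%C -> Ccont (fun w => / f w)%C z.
Proof.
intros Hf Hz.
pose proof (Rcont_Re f z Hf) as F1. pose proof (Rcont_Im f z Hf) as F2.
assert (HD : fst (f z) ^ 2 + snd (f z) ^ 2 <> 0).
{ apply Cmod_gt_0 in Hz. pose proof (Cmod2_alt (f z)) as E. unfold Re, Im in E. nra. }
assert (Rcont (fun w => / (fst (f w) ^ 2 + snd (f w) ^ 2)) z) as Hi.
{ apply (continuous_comp (V:=R_UniformSpace) (fun w => fst (f w) ^ 2 + snd (f w) ^ 2) Rinv).
  - apply (continuous_ext (fun w => Re (f w) * Re (f w) + Im (f w) * Im (f w))).
    { intros w. eqR. unfold Re, Im. ring. }
    apply (continuous_plus (V:=R_NormedModule));
      apply (continuous_mult (K:=R_AbsRing)); assumption.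
  - apply continuous_Rinv. exact HD. }
apply Ccont_pair; apply (continuous_mult (K:=R_AbsRing)); try assumption.
apply (continuous_opp (V:=R_NormedModule)). assumption.
Qed.

Lemma Ccont_comp (f g : C -> C) (z : C) :
  Ccont f z -> Ccont g (f z) -> Ccont (fun w => g (f w)) z.
Proof. apply continuous_comp. Qed.

Lemma Ccont_pow (f : C -> C) (z : C) (n : nat) :
  Ccont f z -> Ccont (fun w => f w ^ n)%C z.
Proof.
intros Hf. induction n as [| n IH]; simpl; [apply Ccont_const | apply Ccont_mult; assumption].
Qed.

Lemma Rcont_gt (f : C -> R) (z : C) (m : R) :
  Rcont f z -> m < f z -> near z (fun w => m < f w).
Proof. intros Hf Hm. exact (Hf (fun r => m < r) (open_gt m (f z) Hm)). Qed.

Lemma Rcont_lt (f : C -> R) (z : C) (m : R) :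
  Rcont f z -> f z < m -> near z (fun w => f w < m).
Proof. intros Hf Hm. exact (Hf (fun r => r < m) (open_lt m (f z) Hm)). Qed.

Lemma near_neq_0 (f : C -> C) (z : C) :
  Ccont f z -> f z <> 0%C -> near z (fun w => f w <> 0%C).
Proof.
intros Hf Hz. apply Cmod_gt_0 in Hz.
generalize (Rcont_gt _ z 0 (Rcont_Cmod f z Hf) Hz). apply filter_imp.
intros w. apply Cmod_gt_0.
Qed.

Ltac ccont := repeat (first [ assumption | match goal with
  | |- continuous (fun w => w) _ => apply Ccont_id
  | |- continuous (fun w => ?a) _ => apply Ccont_const
  | |- continuous (fun w => Cplus _ _) _ => apply Ccont_plus
  | |- continuous (fun w => Cminus _ _) _ => apply Ccont_minus
  | |- continuous (fun w => Cmult _ _) _ => apply Ccont_mult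
  | |- continuous (fun w => Cpow _ _) _ => apply Ccont_pow
  end ]).

(** Here [a] is the derivative at [z], and [g z] plays the role of half the second derivative. A
    continuous quotient [g] in place of a little-o term makes sums, products and compositions
    algebraic identities plus continuity of the new quotient. *)
Definition jet2 (f : C -> C) (z a : C) : Prop :=
  exists g : C -> C, Ccont g z /\
    near z (fun w => f w = (f z + (w - z) * (a + (w - z) * g w))%C).

Lemma jet2_cont (f : C -> C) (z a : C) : jet2 f z a -> Ccont f z.
Proof.
intros [g [Hg Hn]].
refine (continuous_ext_loc (T:=C_UniformSpace) (U:=C_UniformSpace) f
  (fun w => f z + (w - z) * (a + (w - z) * g w))%C z _ _).
- generalize Hn. apply filter_imp. intros w E; symmetry; exact E.
- ccont.
Qed.

Lemma jet2_const (b z : C) : jet2 (fun _ => b) z 0.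
Proof. exists (fun _ => 0%C). split; [ccont |]. apply filter_forall. intros w. Cring. Qed.

Lemma jet2_id (z : C) : jet2 (fun w => w) z 1.
Proof. exists (fun _ => 0%C). split; [ccont |]. apply filter_forall. intros w. Cring. Qed.

Lemma jet2_plus (f g : C -> C) (z a b : C) :
  jet2 f z a -> jet2 g z b -> jet2 (fun w => f w + g w)%C z (a + b)%C.
Proof.
intros [f1 [Hf Ef]] [g1 [Hg Eg]]. exists (fun w => f1 w + g1 w)%C. split; [ccont |].
generalize (filter_and _ _ Ef Eg). apply filter_imp. intros w [-> ->]. Cring.
Qed.

Lemma jet2_mult (f g : C -> C) (z a b : C) :
  jet2 f z a -> jet2 g z b -> jet2 (fun w => f w * g w)%C z (a * g z + f z * b)%C.
Proof.
intros [f1 [Hf Ef]] [g1 [Hg Eg]].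
exists (fun w => f1 w * (g z) + f z * g1 w + (a + (w - z) * f1 w) * (b + (w - z) * g1 w))%C.
split; [ccont |].
generalize (filter_and _ _ Ef Eg). apply filter_imp. intros w [-> ->]. Cring.
Qed.

Lemma jet2_comp (f g : C -> C) (z a b : C) :
  jet2 f z a -> jet2 g (f z) b -> jet2 (fun w => g (f w)) z (b * a)%C.
Proof.
intros Jf [g1 [Hg Eg]]. pose proof (jet2_cont _ _ _ Jf) as Cf.
destruct Jf as [f1 [Hf Ef]].
exists (fun w => b * f1 w + (a + (w - z) * f1 w) ^ 2 * g1 (f w))%C.
split.
{ ccont. apply Ccont_comp; assumption. }
specialize (Cf _ Eg). unfold filtermap in Cf.
generalize (filter_and _ _ Ef Cf). apply filter_imp. intros w [E1 E2].
rewrite E2.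
replace (f w - f z)%C with ((w - z) * (a + (w - z) * f1 w))%C by (rewrite E1; Cring).
Cring.
Qed.

Lemma jet2_Cinv (z : C) : z <> 0%C -> jet2 (fun w => / w)%C z (- / (z * z))%C.
Proof.
intros Hz. exists (fun w => / (z * z) * / w)%C. split.
{ ccont. apply Ccont_inv; [ccont | exact Hz]. }
generalize (near_neq_0 (fun w => w) z (Ccont_id z) Hz). apply filter_imp.
intros w Hw. Cfield. split; assumption.
Qed.

Lemma jet2_inv (f : C -> C) (z a : C) :
  jet2 f z a -> f z <> 0%C -> jet2 (fun w => / f w)%C z (- / (f z * f z) * a)%C.
Proof. intros Jf Hz. apply (jet2_comp f Cinv); [exact Jf | apply jet2_Cinv; exact Hz]. Qed.

Lemma jet2_pow (f : C -> C) (z a : C) (n : nat) :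
  jet2 f z a -> exists b, jet2 (fun w => f w ^ n)%C z b.
Proof.
intros Jf. induction n as [| n [b IH]]; simpl; eexists.
- apply jet2_const.
- apply jet2_mult; [exact Jf | exact IH].
Qed.

(* The increment [l] of [h] satisfies [w - z = l (b + l G)], to be solved for [l]. *)
Lemma jet2_inverse (f h : C -> C) (z b : C) :
  Ccont h z -> near z (fun w => f (h w) = w) -> b <> 0%C ->
  jet2 f (h z) b -> jet2 h z (/ b)%C.
Proof.
intros Hh Hi Hb [G [HG EG]].
pose (k := fun w => (b + (h w - h z) * G (h w))%C).
assert (Hk : Ccont k z) by (unfold k; ccont; apply Ccont_comp; assumption).
assert (Hkz : k z <> 0%C).
{ unfold k. replace (b + (h z - h z) * G (h z))%C with b by Cring. exact Hb. }
(* From w - z = (h w - h z) k(w), the increment of [h] is (w - z) / k(w). Moreover 1/k - 1/b = (b -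
   k)/(b k), and b - k = -(h w - h z) G(h w) = -(w - z) G(h w) / k, which gives this quotient. *)
exists (fun w => - G (h w) * / b * / (k w) * / k w)%C. split.
{ assert (Ccont (fun w => / k w)%C z) by (apply Ccont_inv; assumption).
  ccont. apply (continuous_ext (fun w => 0 - G (h w))%C); [intros w; Cring |].
  ccont. apply Ccont_comp; assumption. }
specialize (Hh _ EG). unfold filtermap in Hh.
pose proof (locally_singleton _ _ Hi) as Ez. simpl in Ez.
generalize (filter_and _ _ Hi (filter_and _ _ Hh (near_neq_0 k z Hk Hkz))).
apply filter_imp. intros w [E1 [E2 E3]].
rewrite E1, Ez in E2.
assert (E4 : (h w = h z + (w - z) * / k w)%C).
{ replace (w - z)%C with ((h w - h z) * k w)%C; [Cfield; exact E3 |].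
  unfold k. symmetry. rewrite E2 at 1. Cring. }
assert (E5 : (k w = b + (w - z) * / k w * G (h w))%C).
{ unfold k at 1. rewrite E4 at 1. Cring. }
rewrite E4 at 1.
assert (E6 : (b = k w - (w - z) * / k w * G (h w))%C) by (rewrite E5 at 1; Cring).
f_equal. f_equal.
transitivity ((k w - (w - z) * / k w * G (h w)) * / b * / k w)%C.
- rewrite <- E6. Cfield. split; assumption.
- Cfield. split; assumption.
Qed.

(** * The complex exponential *)

Lemma Ccont_lip (f : C -> C) (z : C) (K d : R) : 0 < d ->
  (forall w, Cmod (w - z) < d -> Cmod (f w - f z) <= K * Cmod (w - z)) -> Ccont f z.
Proof.
intros Hd H P HP. apply near_Cmod in HP. destruct HP as [e He].
apply near_Cmod.
assert (HK : 0 < Rabs K + 1) by (pose proof (Rabs_pos K); lra).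
assert (Hm : 0 < Rmin d (e / (Rabs K + 1))).
{ apply Rmin_pos; [exact Hd |]. apply Rdiv_lt_0_compat; [apply cond_pos | exact HK]. }
exists (mkposreal _ Hm). intros w Hw. simpl in Hw. apply He.
pose proof (Rmin_l d (e / (Rabs K + 1))). pose proof (Rmin_r d (e / (Rabs K + 1))).
assert (Hw' : Cmod (w - z) < e / (Rabs K + 1)) by lra.
apply Rlt_div_r in Hw'; [| lra].
pose proof (H w ltac:(lra)). pose proof (Rle_abs K). pose proof (Cmod_ge_0 (w - z)). nra.
Qed.

Lemma Cmod_le_abs (z : C) : Cmod z <= Rabs (Re z) + Rabs (Im z).
Proof.
pose proof (Rabs_pos (Re z)). pose proof (Rabs_pos (Im z)).
apply Rsqr_incr_0; [| apply Cmod_ge_0 | lra].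
rewrite !Rsqr_pow2, Cmod2_alt, <- (pow2_abs (Re z)), <- (pow2_abs (Im z)). nra.
Qed.

Lemma im_le_Cmod (z : C) : Rabs (Im z) <= Cmod z.
Proof. apply Rle_trans with (2 := Rmax_Cmod z). apply Rmax_r. Qed.

(** By the mean value theorem, |u x| = |v y| |x| for some |y| <= |x|. The factor 1/(k+1) that
    integration would give is dropped, as only some constant is wanted. Three applications turn a
    bound on a third derivative into a cubic Taylor remainder. *)
Lemma integrate_power_bound (u v : R -> R) (K : R) (k : nat) : 0 <= K -> u 0 = 0 ->
  (forall x, is_derive u x (v x)) ->
  (forall x, Rabs x <= 1 -> Rabs (v x) <= K * Rabs x ^ k) ->
  forall x, Rabs x <= 1 -> Rabs (u x) <= K * Rabs x ^ S k.
Proof.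
intros HK H0 Hd Hv x Hx.
destruct (MVT_gen u 0 x v) as [y [Hy E]].
- intros t _. apply Hd.
- intros t _. apply derivable_continuous_pt. exists (v t). apply is_derive_Reals, Hd.
- rewrite H0, !Rminus_0_r in E. rewrite E, Rabs_mult.
  assert (Hyx : Rabs y <= Rabs x).
  { revert Hy. unfold Rmin, Rmax, Rabs.
    destruct (Rle_dec 0 x), (Rcase_abs y), (Rcase_abs x); intros; lra. }
  pose proof (Hv y ltac:(lra)).
  pose proof (pow_incr (Rabs y) (Rabs x) k (conj (Rabs_pos y) Hyx)).
  pose proof (Rabs_pos x). simpl.
  assert (Rabs (v y) <= K * Rabs x ^ k) by nra. nra.
Qed.

Lemma exp_taylor2 (x : R) : Rabs x <= 1 -> Rabs (exp x - 1 - x - x ^ 2 / 2) <= 3 * Rabs x ^ 3.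
Proof.
intros Hx.
apply (integrate_power_bound (fun x => exp x - 1 - x - x ^ 2 / 2) (fun x => exp x - 1 - x) 3 2);
  [lra | rewrite exp_0; field | intros t; auto_derive; [easy | field] | | exact Hx].
apply (integrate_power_bound (fun x => exp x - 1 - x) (fun x => exp x - 1) 3 1);
  [lra | rewrite exp_0; field | intros t; auto_derive; [easy | field] | ].
apply (integrate_power_bound (fun x => exp x - 1) exp 3 0);
  [lra | rewrite exp_0; field | intros t; auto_derive; [easy | field] | ].
intros t Ht. pose proof (exp_pos t). rewrite Rabs_pos_eq by lra. simpl.
apply Rabs_le_between in Ht. pose proof exp_le_3.
destruct (Req_dec t 1) as [-> | N]; [lra |]. pose proof (exp_increasing t 1 ltac:(lra)). lra.
Qed.

Lemma sin_taylor2 (x : R) : Rabs x <= 1 -> Rabs (sin x - x) <= 1 * Rabs x ^ 3.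
Proof.
intros Hx.
apply (integrate_power_bound (fun x => sin x - x) (fun x => cos x - 1) 1 2);
  [lra | rewrite sin_0; field | intros t; auto_derive; [easy | field] | | exact Hx].
apply (integrate_power_bound (fun x => cos x - 1) (fun x => - sin x) 1 1);
  [lra | rewrite cos_0; field | intros t; auto_derive; [easy | field] | ].
apply (integrate_power_bound (fun x => - sin x) (fun x => - cos x) 1 0);
  [lra | rewrite sin_0; field | intros t; auto_derive; [easy | field] | ].
intros t Ht. simpl. rewrite Rabs_Ropp. pose proof (COS_bound t). apply Rabs_le. lra.
Qed.

Lemma cos_taylor2 (x : R) : Rabs x <= 1 -> Rabs (cos x - 1 + x ^ 2 / 2) <= 1 * Rabs x ^ 3.
Proof.
intros Hx.
apply (integrate_power_bound (fun x => cos x - 1 + x ^ 2 / 2) (fun x => - sin x + x) 1 2);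
  [lra | rewrite cos_0; field | intros t; auto_derive; [easy | field] | | exact Hx].
apply (integrate_power_bound (fun x => - sin x + x) (fun x => - cos x + 1) 1 1);
  [lra | rewrite sin_0; field | intros t; auto_derive; [easy | field] | ].
apply (integrate_power_bound (fun x => - cos x + 1) sin 1 0);
  [lra | rewrite cos_0; field | intros t; auto_derive; [easy | field] | ].
intros t Ht. simpl. pose proof (SIN_bound t). apply Rabs_le. lra.
Qed.

Definition Cexp (z : C) : C := (exp (Re z) * cos (Im z), exp (Re z) * sin (Im z)).

Lemma Cexp_plus (z w : C) : Cexp (z + w) = (Cexp z * Cexp w)%C.
Proof.
destruct z as [a b], w as [x y]. unfold Cexp, Cplus, Cmult; cbn [Re Im fst snd].
rewrite exp_plus, cos_plus, sin_plus. f_equal; ring.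
Qed.

Lemma Cmod_Cexp (z : C) : Cmod (Cexp z) = exp (Re z).
Proof.
pose proof (exp_pos (Re z)). apply Rsqr_inj; [apply Cmod_ge_0 | lra |].
rewrite !Rsqr_pow2, Cmod2_alt. unfold Cexp; cbn [Re Im fst snd].
pose proof (sin2_cos2 (Im z)) as E. unfold Rsqr in E. unfold Re in *.
replace ((exp (fst z) * cos (Im z)) ^ 2 + (exp (fst z) * sin (Im z)) ^ 2) with
  (exp (fst z) ^ 2 * (sin (Im z) * sin (Im z) + cos (Im z) * cos (Im z))) by ring.
rewrite E. ring.
Qed.

Lemma Cexp_neq_0 (z : C) : Cexp z <> 0%C.
Proof. apply Cmod_gt_0. rewrite Cmod_Cexp. apply exp_pos. Qed.

(** The constant is not sharp: the real part contributes 1/2 + 1/4 + 5/2 + 3 and the imaginary part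
    1/2 + 5/2 + 3, each at most 13/2, and the modulus is at most the sum of both. *)
Lemma Cexp_taylor2 (h : C) : Cmod h <= 1 ->
  Cmod (Cexp h - 1 - h - h * h / 2) <= 13 * Cmod h ^ 3.
Proof.
intros Hh.
pose proof (re_le_Cmod h) as Hx. pose proof (im_le_Cmod h) as Hy.
apply Rle_trans with (1 := Cmod_le_abs _).
pose proof (exp_taylor2 (Re h) ltac:(lra)) as E1.
pose proof (cos_taylor2 (Im h) ltac:(lra)) as E2.
pose proof (sin_taylor2 (Im h) ltac:(lra)) as E3.
pose proof (Cmod_ge_0 h) as Hm.
pose proof (pow_incr _ _ 3 (conj (Rabs_pos (Re h)) Hx)) as P1.
pose proof (pow_incr _ _ 3 (conj (Rabs_pos (Im h)) Hy)) as P2.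
set (m := Cmod h) in *. set (x := Re h) in *. set (y := Im h) in *.
set (r1 := exp x - 1 - x - x ^ 2 / 2) in *.
set (r2 := cos y - 1 + y ^ 2 / 2) in *.
set (r3 := sin y - y) in *.
(* Multiply exp x = 1 + x + x^2/2 + r1 by cos y = 1 - y^2/2 + r2, keeping cos y unexpanded next to
   r1, and subtract the terms of degree at most 2. The imaginary part is treated alike. *)
assert (Hre : Re (Cexp h - 1 - h - h * h / 2) =
  - (x * y ^ 2 / 2) + (- (x ^ 2 * y ^ 2 / 4)) + (1 + x + x ^ 2 / 2) * r2 + r1 * cos y).
{ unfold r1, r2, Cexp, x, y. destruct h as [a b].
  unfold Cdiv, Cminus, Cplus, Copp, Cmult, Cinv, RtoC; cbn [Re Im fst snd]. field. }
assert (Him : Im (Cexp h - 1 - h - h * h / 2) =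
  x ^ 2 * y / 2 + (1 + x + x ^ 2 / 2) * r3 + r1 * sin y).
{ unfold r1, r3, Cexp, x, y. destruct h as [a b].
  unfold Cdiv, Cminus, Cplus, Copp, Cmult, Cinv, RtoC; cbn [Re Im fst snd]. field. }
rewrite Hre, Him.
assert (M3 : 0 <= m ^ 3) by (apply pow_le; lra).
assert (M4 : m ^ 4 <= m ^ 3) by (simpl in *; nra).
assert (Hc : Rabs (cos y) <= 1) by (apply Rabs_le; apply COS_bound).
assert (Hs : Rabs (sin y) <= 1) by (apply Rabs_le; apply SIN_bound).
assert (Ha : Rabs (1 + x + x ^ 2 / 2) <= 5 / 2).
{ apply Rabs_le_between in Hx. apply Rabs_le. nra. }
assert (B1 : Rabs (x * y ^ 2 / 2) <= m ^ 3 / 2).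
{ unfold Rdiv. rewrite !Rabs_mult, <- RPow_abs, (Rabs_pos_eq (/ 2)) by lra.
  assert (Rabs x * Rabs y ^ 2 <= m * m ^ 2); [| simpl in *; lra].
  apply Rmult_le_compat; [apply Rabs_pos | apply pow_le, Rabs_pos | exact Hx |].
  apply pow_incr; split; [apply Rabs_pos | exact Hy]. }
assert (B2 : Rabs (x ^ 2 * y ^ 2 / 4) <= m ^ 3 / 4).
{ unfold Rdiv. rewrite !Rabs_mult, <- !RPow_abs, (Rabs_pos_eq (/ 4)) by lra.
  assert (Rabs x ^ 2 * Rabs y ^ 2 <= m ^ 2 * m ^ 2); [| simpl in *; lra].
  apply Rmult_le_compat; try (apply pow_le, Rabs_pos);
    apply pow_incr; split; try apply Rabs_pos; assumption. }
assert (B3 : Rabs (x ^ 2 * y / 2) <= m ^ 3 / 2).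
{ unfold Rdiv. rewrite !Rabs_mult, <- RPow_abs, (Rabs_pos_eq (/ 2)) by lra.
  assert (Rabs x ^ 2 * Rabs y <= m ^ 2 * m); [| simpl in *; lra].
  apply Rmult_le_compat; [apply pow_le, Rabs_pos | apply Rabs_pos | | exact Hy].
  apply pow_incr; split; [apply Rabs_pos | exact Hx]. }
assert (B4 : Rabs ((1 + x + x ^ 2 / 2) * r2) <= 5 / 2 * m ^ 3).
{ rewrite Rabs_mult. apply Rmult_le_compat; try apply Rabs_pos; lra. }
assert (B5 : Rabs ((1 + x + x ^ 2 / 2) * r3) <= 5 / 2 * m ^ 3).
{ rewrite Rabs_mult. apply Rmult_le_compat; try apply Rabs_pos; lra. }
assert (B6 : Rabs (r1 * cos y) <= 3 * m ^ 3 * 1).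
{ rewrite Rabs_mult. apply Rmult_le_compat; try apply Rabs_pos; lra. }
assert (B7 : Rabs (r1 * sin y) <= 3 * m ^ 3 * 1).
{ rewrite Rabs_mult. apply Rmult_le_compat; try apply Rabs_pos; lra. }
apply Rabs_le_between in B1, B2, B3, B4, B5, B6, B7.
assert (forall a b c, - c <= a <= c -> - (13 * m ^ 3 - c) <= b <= 13 * m ^ 3 - c ->
  Rabs a + Rabs b <= 13 * m ^ 3) as Hab.
{ intros a b d H1 H2. apply Rabs_le in H1, H2. lra. }
apply (Hab _ _ (13 / 2 * m ^ 3)); lra.
Qed.

Lemma jet2_Cexp (z : C) : jet2 Cexp z (Cexp z).
Proof.
(* The functional equation reduces the expansion at [z] to one at 0. The value 1/2 at h = 0 is the
   limit of the quotient, so the cubic remainder bound makes [G] Lipschitz at 0 with constant 13. *)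
pose (G := fun h : C => if Req_EM_T (Cmod h) 0 then (1 / 2)%C
  else ((Cexp h - 1 - h) / (h * h))%C).
assert (E0 : Cexp 0 = 1%C).
{ unfold Cexp, RtoC; cbn [Re Im fst snd]. rewrite exp_0, cos_0, sin_0. f_equal; ring. }
assert (G0 : G 0%C = (1 / 2)%C).
{ unfold G. rewrite Cmod_0. destruct (Req_EM_T 0 0); [reflexivity | lra]. }
exists (fun w => Cexp z * G (w - z))%C. split.
- ccont. apply (Ccont_comp (fun w => w - z)%C G); [ccont |].
  assert (Ez : (z - z = 0)%C) by ring. cbv beta. rewrite Ez.
  apply (Ccont_lip G 0 13 1); [lra |]. intros h Hh.
  rewrite G0. replace (h - 0)%C with h in * by Cring.
  unfold G. destruct (Req_EM_T (Cmod h) 0) as [E | N].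
  + replace (1 / 2 - 1 / 2)%C with (RtoC 0) by Cring. rewrite Cmod_0, E. lra.
  + assert (h <> 0)%C by (intros ->; apply N, Cmod_0).
    replace ((Cexp h - 1 - h) / (h * h) - 1 / 2)%C
      with ((Cexp h - 1 - h - h * h / 2) / (h * h))%C by (Cfield; assumption).
    rewrite Cmod_div by (apply Cmult_neq_0; assumption). rewrite Cmod_mult.
    pose proof (Cmod_ge_0 h). pose proof (Cexp_taylor2 h ltac:(lra)).
    apply Rle_div_l; [nra |]. simpl in *; lra.
- apply filter_forall. intros w.
  replace (Cexp w) with (Cexp z * Cexp (w - z))%C by (rewrite <- Cexp_plus; f_equal; Cring).
  unfold G. destruct (Req_EM_T (Cmod (w - z)) 0) as [E | N].
  + apply Cmod_eq_0 in E. rewrite E, E0. Cring.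
  + assert (w - z <> 0)%C by (intros E; apply N; rewrite E; apply Cmod_0).
    Cfield. assumption.
Qed.

(** * The principal logarithm *)

(* The half-angle formula gives the principal logarithm on the plane slit along
   the negative real axis, which is where [Re w + Cmod w > 0]. *)
Definition slit (w : C) : Prop := 0 < Re w + Cmod w.

Definition Clog (w : C) : C := (ln (Cmod w), 2 * atan (Im w / (Re w + Cmod w))).

Lemma slit_neq_0 (w : C) : slit w -> w <> 0%C.
Proof. intros H ->. unfold slit in H. rewrite Cmod_0 in H. cbn in H. lra. Qed.

Lemma slit_Re_ge_0 (w : C) : w <> 0%C -> 0 <= Re w -> slit w.
Proof. intros H1 H2. apply Cmod_gt_0 in H1. unfold slit. lra. Qed.

Lemma Cexp_Clog (w : C) : slit w -> Cexp (Clog w) = w.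
Proof.
intros Hs. pose proof (proj1 (Cmod_gt_0 w) (slit_neq_0 w Hs)) as Hm.
pose proof (Cmod2_alt w) as E. unfold slit in Hs.
unfold Cexp, Clog; cbn [Re Im fst snd]. rewrite exp_ln by exact Hm.
set (m := Cmod w) in *.
destruct w as [x y]; cbn [Re Im fst snd] in *.
set (u := y / (x + m)).
rewrite cos_2a, sin_2a, cos_atan, sin_atan.
(* [u] is the tangent of half the argument. With y^2 = (m - x)(m + x) both double-angle formulas
   become rational in x, y and m. *)
assert (Hu : u * u = (m - x) / (x + m)).
{ unfold u. replace (y / (x + m) * (y / (x + m))) with (y * y / ((x + m) * (x + m)))
    by (field; lra).
  replace (y * y) with ((m - x) * (x + m)) by nra. field. lra. }
assert (Hr : sqrt (1 + u²) * sqrt (1 + u²) = 2 * m / (x + m)).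
{ rewrite sqrt_sqrt by (pose proof (Rle_0_sqr u); lra).
  unfold Rsqr. rewrite Hu. field. lra. }
assert (Hp : 0 < sqrt (1 + u²)) by (apply sqrt_lt_R0; pose proof (Rle_0_sqr u); lra).
set (s := sqrt (1 + u²)) in *.
f_equal.
- replace (m * (1 / s * (1 / s) - u / s * (u / s))) with (m * (1 - u * u) / (s * s))
    by (field; lra).
  rewrite Hr, Hu. field. lra.
- replace (m * (2 * (u / s) * (1 / s))) with (m * (2 * u) / (s * s)) by (field; lra).
  rewrite Hr. unfold u. field. lra.
Qed.

Lemma Im_Clog_bound (w : C) : - PI < Im (Clog w) < PI.
Proof.
pose proof (atan_bound (Im w / (Re w + Cmod w))) as [H1 H2].
unfold Clog; cbn [Re Im fst snd]. lra.
Qed.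

(** [Carg] is given by cases on the sign of the imaginary part, which hides its continuity across
    the positive real axis. This identity moves every sector condition to the continuous [Clog]. *)
Lemma Carg_Clog (w : C) : slit w -> Carg w = Im (Clog w).
Proof.
intros Hs. apply Carg_spec; [apply slit_neq_0, Hs |]. split.
- pose proof (Im_Clog_bound w). lra.
- rewrite <- (Cexp_Clog w Hs) at 1.
  pose proof (proj1 (Cmod_gt_0 w) (slit_neq_0 w Hs)) as Hm.
  unfold Cexp. unfold Clog at 1 3; cbn [Re Im fst snd]. rewrite exp_ln by exact Hm.
  unfold Cmult, RtoC; cbn [fst snd]. f_equal; ring.
Qed.

Lemma Clog_Cexp (z : C) : - PI < Im z < PI -> slit (Cexp z) /\ Clog (Cexp z) = z.
Proof.
intros Hz. pose proof (exp_pos (Re z)) as Hp.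
assert (Hs : slit (Cexp z)).
{ unfold slit. rewrite Cmod_Cexp. unfold Cexp; cbn [Re Im fst snd].
  change (fst z) with (Re z).
  assert (- 1 < cos (Im z)); [| nra].
  rewrite <- cos_PI. destruct (Rle_lt_dec 0 (Im z)).
  - apply cos_decreasing_1; lra.
  - rewrite <- (cos_neg (Im z)). apply cos_decreasing_1; lra. }
split; [exact Hs |].
pose proof (Carg_Clog _ Hs) as Ea.
assert (Carg (Cexp z) = Im z) as Eb.
{ apply Carg_spec; [apply Cexp_neq_0 |]. split; [lra |].
  rewrite Cmod_Cexp. unfold Cexp, Cmult, RtoC; cbn [fst snd]. f_equal; ring. }
rewrite Eb in Ea. rewrite (surjective_pairing z) at 2.
rewrite (surjective_pairing (Clog (Cexp z))). f_equal; [| symmetry; exact Ea].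
unfold Clog; cbn [fst snd]. rewrite Cmod_Cexp. apply ln_exp.
Qed.

Lemma Ccont_Clog (z : C) : slit z -> Ccont Clog z.
Proof.
intros Hs. pose proof (proj1 (Cmod_gt_0 z) (slit_neq_0 z Hs)) as Hm.
apply Ccont_pair.
- apply (continuous_comp (V:=R_UniformSpace) (fun w => Cmod w) ln).
  + apply Rcont_Cmod, Ccont_id.
  + apply (ex_derive_continuous (K:=R_AbsRing) (V:=R_NormedModule) ln (Cmod z)). eexists. apply is_derive_ln. exact Hm.
- apply (continuous_mult (K:=R_AbsRing)); [apply continuous_const |].
  apply (continuous_comp (V:=R_UniformSpace) (fun w => Im w / (Re w + Cmod w)) atan).
  + apply (continuous_mult (K:=R_AbsRing)); [apply (Rcont_Im _ _ (Ccont_id z)) |].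
    apply (continuous_comp (V:=R_UniformSpace) (fun w => Re w + Cmod w) Rinv).
    * apply (continuous_plus (V:=R_NormedModule));
        [apply (Rcont_Re _ _ (Ccont_id z)) | apply Rcont_Cmod, Ccont_id].
    * apply continuous_Rinv. unfold slit in Hs. lra.
  + apply (ex_derive_continuous (K:=R_AbsRing) (V:=R_NormedModule) atan (Im z / (Re z + Cmod z))).
    eexists. apply is_derive_atan.
Qed.

Lemma near_slit (z : C) : slit z -> near z slit.
Proof.
intros Hs. apply (Rcont_gt (fun w => Re w + Cmod w)); [| exact Hs].
apply (continuous_plus (V:=R_NormedModule));
  [apply (Rcont_Re _ _ (Ccont_id z)) | apply Rcont_Cmod, Ccont_id].
Qed.

Lemma jet2_Clog (z : C) : slit z -> jet2 Clog z (/ z)%C.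
Proof.
intros Hs. apply (jet2_inverse Cexp).
- apply Ccont_Clog, Hs.
- generalize (near_slit z Hs). apply filter_imp. exact Cexp_Clog.
- apply slit_neq_0, Hs.
- rewrite <- (Cexp_Clog z Hs) at 2. apply jet2_Cexp.
Qed.

Lemma sector_Re_pos (alpha : R) (w : C) : 0 < alpha <= 1 -> sector alpha w -> 0 < Re w.
Proof.
intros Ha [H0 Hs]. pose proof (proj1 (Cmod_gt_0 w) H0) as Hm.
destruct (proj1 (Carg_spec w (Carg w) H0) eq_refl) as [_ E].
rewrite E. unfold Cmult, RtoC; cbn [Re fst snd].
apply Rabs_lt_between in Hs. pose proof PI_RGT_0.
assert (0 < cos (Carg w)) by (apply cos_gt_0; nra). nra.
Qed.

Lemma sector_slit (alpha : R) (w : C) : 0 < alpha <= 1 -> sector alpha w -> slit w.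
Proof.
intros Ha Hw. pose proof (sector_Re_pos alpha w Ha Hw).
apply slit_Re_ge_0; [apply Hw | lra].
Qed.

Lemma sector_Clog (alpha : R) (w : C) : slit w ->
  sector alpha w <-> Rabs (Im (Clog w)) < PI * alpha / 2.
Proof.
intros Hs. unfold sector. rewrite (Carg_Clog w Hs).
pose proof (slit_neq_0 w Hs). tauto.
Qed.

Lemma Rcont_abs_Im_Clog (z : C) : slit z -> Rcont (fun w => Rabs (Im (Clog w))) z.
Proof.
intros Hs. apply (continuous_comp (V:=R_UniformSpace) (fun w => Im (Clog w)) Rabs).
- apply (Rcont_Im _ _ (Ccont_Clog z Hs)).
- apply continuous_Rabs.
Qed.

Lemma near_sector (alpha : R) (z : C) : 0 < alpha <= 1 ->
  sector alpha z -> near z (sector alpha).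
Proof.
intros Ha Hz. pose proof (sector_slit alpha z Ha Hz) as Hs.
apply (sector_Clog alpha z Hs) in Hz.
generalize (filter_and _ _ (near_slit z Hs)
  (Rcont_lt _ z _ (Rcont_abs_Im_Clog z Hs) Hz)).
apply filter_imp. intros w [H1 H2]. apply sector_Clog; assumption.
Qed.

(** * Power series on the unit disk *)

Notation Cseries := (@is_series C_AbsRing C_NormedModule).

Lemma Cseries_unique (a : nat -> C) (l l' : C) : Cseries a l -> Cseries a l' -> l = l'.
Proof. intros H H'. exact (filterlim_locally_unique _ _ _ H H'). Qed.

Lemma Cseries_ext (a a' : nat -> C) (l : C) :
  (forall k, a k = a' k) -> Cseries a l -> Cseries a' l.
Proof. intros E. apply is_series_ext. exact E. Qed.

Lemma Cseries_scal (c : C) (a : nat -> C) (l : C) :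
  Cseries a l -> Cseries (fun k => c * a k)%C (c * l)%C.
Proof. exact (is_series_scal (K:=C_AbsRing) (V:=C_NormedModule) c a l). Qed.

Lemma Cseries_minus (a b : nat -> C) (l l' : C) :
  Cseries a l -> Cseries b l' -> Cseries (fun k => a k - b k)%C (l - l')%C.
Proof. exact (is_series_minus (K:=C_AbsRing) (V:=C_NormedModule) a b l l'). Qed.

Lemma Cseries_tail (a : nat -> C) (l : C) :
  Cseries a l <-> Cseries (fun k => a (S k)) (l - a 0%nat)%C.
Proof.
split.
- intros H. apply (is_series_incr_1 (K:=C_AbsRing) (V:=C_NormedModule)).
  refine (eq_ind _ (fun t => Cseries a t) H _ _).
  change (l = (l - a 0%nat) + a 0%nat)%C. ring.
- intros H. apply (is_series_decr_1 (K:=C_AbsRing) (V:=C_NormedModule)). exact H.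
Qed.

Lemma Cseries_bound (a : nat -> C) (l : C) (c : nat -> R) (s : R) :
  Cseries a l -> is_series c s -> (forall k, Cmod (a k) <= c k) -> Cmod l <= s.
Proof.
intros Ha Hc Hle.
apply (is_lim_seq_le (fun n => Cmod (sum_n (G:=C_AbelianMonoid) a n)) (sum_n c) (Cmod l) s).
- intros n. apply Rle_trans with (1 := norm_sum_n_m (K:=C_AbsRing) (V:=C_NormedModule) a 0 n).
  apply sum_n_m_le. exact Hle.
- apply (filterlim_comp _ _ _ (sum_n (G:=C_AbelianMonoid) a) Cmod eventually
    (@locally C_UniformSpace l)).
  + exact Ha.
  + exact (Rcont_Cmod (fun w => w) l (Ccont_id l)).
- exact Hc.
Qed.

(* By Cauchy-Hadamard this says that the radius of convergence is at least 1. *)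
Definition tame (b : nat -> C) : Prop :=
  forall r : R, 0 < r < 1 -> exists M : R, forall k : nat, Cmod (b k) * r ^ k <= M.

Definition sums_to (b : nat -> C) (f : C -> C) : Prop :=
  forall w : C, disk w -> Cseries (fun k => w ^ k * b k)%C (f w).

Lemma bounded_of_eventually (u : nat -> R) (N : nat) (B : R) :
  (forall k, (N <= k)%nat -> u k <= B) -> exists M, forall k, u k <= M.
Proof.
revert B. induction N as [| N IH]; intros B H.
- exists B. intros k. apply H. lia.
- apply (IH (Rmax B (u N))). intros k Hk.
  destruct (Nat.eq_dec k N) as [-> | Hn]; [apply Rmax_r |].
  apply Rle_trans with (2 := Rmax_l _ _). apply H. lia.
Qed.

Lemma sums_to_tame (b : nat -> C) (f : C -> C) : sums_to b f -> tame b.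
Proof.
intros Hs r Hr.
assert (Hd : disk r) by (unfold disk; rewrite Cmod_R, Rabs_pos_eq; lra).
pose proof (ex_intro _ _ (Hs r Hd) : ex_series (K:=C_AbsRing) (V:=C_NormedModule) _) as He.
(* The Cauchy criterion is used on blocks of a single term: from N on, each term of the series at
   [r] has modulus below 1. *)
destruct (Cauchy_ex_series (K:=C_AbsRing) (V:=C_CompleteNormedModule) _ He (mkposreal 1 Rlt_0_1)) as [N HN]. simpl in HN.
apply (bounded_of_eventually _ N 1). intros k Hk.
specialize (HN k k Hk Hk). rewrite sum_n_n in HN.
change (Cmod (r ^ k * b k)%C < 1) in HN.
rewrite Cmod_mult, Cmod_pow, Cmod_R, Rabs_pos_eq in HN by lra. lra.
Qed.

(** Tameness is used at the midpoint s of R0 and 1, giving the ratio r = R0 / s < 1. The midpoint is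
    positive even for R0 = 0, a radius at which [tame] itself says nothing. *)
Lemma tame_geom (b : nat -> C) (R0 : R) : tame b -> 0 <= R0 < 1 ->
  exists M r, 0 <= r < 1 /\ forall k, R0 ^ k * Cmod (b k) <= M * r ^ k.
Proof.
intros Hb HR. set (s := (1 + R0) / 2).
assert (Hs : 0 < s < 1) by (unfold s; lra).
destruct (Hb s Hs) as [M HM].
exists M, (R0 / s). split.
- split; [apply Rdiv_le_0_compat; lra |]. apply Rlt_div_l; unfold s; lra.
- intros k. unfold Rdiv. rewrite Rpow_mult_distr, pow_inv.
  pose proof (pow_lt s k (proj1 Hs)). pose proof (pow_le R0 k (proj1 HR)).
  apply Rle_trans with (R0 ^ k * (M * / s ^ k)); [| lra].
  apply Rmult_le_compat_l; [assumption |]. apply Rle_div_r; [lra |]. apply HM.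
Qed.

Lemma tame_ex_sum (b : nat -> C) (w : C) : tame b -> disk w ->
  exists l, Cseries (fun k => w ^ k * b k)%C l.
Proof.
intros Hb Hw. destruct (tame_geom b (Cmod w) Hb (conj (Cmod_ge_0 w) Hw)) as [M [r [Hr Hle]]].
apply (ex_series_le (K:=C_AbsRing) (V:=C_CompleteNormedModule) _ (fun k => M * r ^ k)).
- intros k. change (Cmod (w ^ k * b k)%C <= M * r ^ k). rewrite Cmod_mult, Cmod_pow. apply Hle.
- apply (ex_series_scal (K:=R_AbsRing) (V:=R_NormedModule)).
  apply ex_series_geom. rewrite Rabs_pos_eq; lra.
Qed.

Lemma tame_sums_to (b : nat -> C) : tame b -> exists f, sums_to b f.
Proof.
intros Hb.
assert (H : forall w, exists l, disk w -> Cseries (fun k => w ^ k * b k)%C l).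
{ intros w. destruct (Rlt_dec (Cmod w) 1) as [Hw | Hw].
  - destruct (tame_ex_sum b w Hb Hw) as [l Hl]. exists l. intros _. exact Hl.
  - exists (RtoC 0). intros Hd. contradiction. }
exists (fun w => proj1_sig (constructive_indefinite_description _ (H w))).
intros w. exact (proj2_sig (constructive_indefinite_description _ (H w))).
Qed.

Lemma sums_to_bounded (b : nat -> C) (f : C -> C) (R0 : R) : sums_to b f -> 0 <= R0 < 1 ->
  exists B, forall w, Cmod w <= R0 -> Cmod (f w) <= B.
Proof.
intros Hf HR. destruct (tame_geom b R0 (sums_to_tame b f Hf) HR) as [M [r [Hr Hle]]].
exists (M * / (1 - r)). intros w Hw.
apply (Cseries_bound (fun k => w ^ k * b k)%C (f w) (fun k => M * r ^ k)).
- apply Hf. unfold disk. lra.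
- apply (is_series_scal (K:=R_AbsRing) (V:=R_NormedModule)).
  apply is_series_geom. rewrite Rabs_pos_eq; lra.
- intros k. apply Rle_trans with (2 := Hle k). rewrite Cmod_mult, Cmod_pow.
  apply Rmult_le_compat_r; [apply Cmod_ge_0 |]. apply pow_incr. split; [apply Cmod_ge_0 | exact Hw].
Qed.

(* Synthetic division of [f - f z] by [w - z]: the coefficients of the quotient are
   [b1 j = b (j+1) + b (j+2) z + b (j+3) z^2 + ...]. *)
Lemma sums_to_divide (b : nat -> C) (f : C -> C) (z : C) : sums_to b f -> disk z ->
  exists b1 f1, sums_to b1 f1 /\ (forall j, b1 j = b (S j) + z * b1 (S j))%C /\
    forall w, disk w -> f w = (f z + (w - z) * f1 w)%C.
Proof.
intros Hf Hz. pose proof (sums_to_tame b f Hf) as Hb.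
assert (Hshift : forall j, tame (fun i => b (S j + i)%nat)).
{ intros j r Hr. destruct (Hb r Hr) as [M HM]. exists (M * / r ^ S j). intros k.
  apply (Rle_div_r _ _ (r ^ S j)); [apply pow_lt; lra |].
  rewrite Rmult_assoc, <- pow_add, (Nat.add_comm k). apply HM. }
pose (P := fun j => constructive_indefinite_description _
  (tame_ex_sum (fun i => b (S j + i)%nat) z (Hshift j) Hz)).
pose (b1 := fun j => proj1_sig (P j)).
assert (S1 : forall j, Cseries (fun i => z ^ i * b (S j + i)%nat)%C (b1 j))
  by (intros j; exact (proj2_sig (P j))).
assert (Hrec : forall j, b1 j = (b (S j) + z * b1 (S j))%C).
{ intros j. apply (Cseries_unique _ _ _ (S1 j)). apply Cseries_tail.
  replace (b (S j) + z * b1 (S j) - z ^ 0 * b (S j + 0)%nat)%C with (z * b1 (S j))%C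
    by (rewrite Nat.add_0_r; simpl; ring).
  apply (Cseries_ext (fun i => z * (z ^ i * b (S (S j) + i)%nat))%C).
  - intros i. replace (S j + S i)%nat with (S (S j) + i)%nat by lia. simpl; ring.
  - apply Cseries_scal, S1. }
assert (Hb1 : tame b1).
(* The series for [b1 j] is dominated by a geometric one of ratio |z| / s, so the radius must exceed
   |z|. Raising [r] to [s] is harmless, because r^j <= s^j. *)
{ intros r Hr. set (s := Rmax r ((1 + Cmod z) / 2)).
  pose proof (Cmod_ge_0 z) as Hz0. unfold disk in Hz.
  assert (Hs : r <= s /\ Cmod z < s < 1).
  { unfold s. pose proof (Rmax_l r ((1 + Cmod z) / 2)). pose proof (Rmax_r r ((1 + Cmod z) / 2)).
    repeat split; [lra | lra | apply Rmax_lub_lt; lra]. }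
  destruct (Hb s ltac:(lra)) as [M HM].
  exists (M * / s * / (1 - Cmod z / s)). intros j.
  assert (Hq : 0 <= Cmod z / s < 1).
  { split; [apply Rdiv_le_0_compat; lra | apply Rlt_div_l; lra]. }
  pose proof (pow_lt s j ltac:(lra)) as Hsj.
  apply Rle_trans with (Cmod (b1 j) * s ^ j).
  { apply Rmult_le_compat_l; [apply Cmod_ge_0 |]. apply pow_incr; lra. }
  apply Rle_div_r; [exact Hsj |].
  replace (M * / s * / (1 - Cmod z / s) / s ^ j)
    with ((M * / s * / s ^ j) * / (1 - Cmod z / s)) by (unfold Rdiv; ring).
  apply (Cseries_bound _ _ (fun i => (M * / s * / s ^ j) * (Cmod z / s) ^ i) _ (S1 j)).
  - apply (is_series_scal (K:=R_AbsRing) (V:=R_NormedModule)).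
    apply is_series_geom. rewrite Rabs_pos_eq; lra.
  - intros i. rewrite Cmod_mult, Cmod_pow. unfold Rdiv. rewrite Rpow_mult_distr, pow_inv.
    pose proof (HM (S j + i)%nat) as H. rewrite pow_add in H. simpl (s ^ S j) in H.
    pose proof (pow_lt s i ltac:(lra)) as Hsi. pose proof (pow_le (Cmod z) i Hz0).
    assert (Cmod (b (S j + i)%nat) <= M * / s * / s ^ j * / s ^ i).
    { apply (Rmult_le_reg_r (s * s ^ j * s ^ i)).
      - apply Rmult_lt_0_compat; [apply Rmult_lt_0_compat; lra | exact Hsi].
      - apply Rle_trans with (1 := H). right. field. lra. }
    nra. }
destruct (tame_sums_to b1 Hb1) as [f1 Hf1].
exists b1, f1. split; [exact Hf1 | split; [exact Hrec |]].
assert (Ez : f z = (b 0%nat + z * b1 0%nat)%C).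
{ apply (Cseries_unique _ _ _ (Hf z Hz)). apply Cseries_tail.
  replace (b 0%nat + z * b1 0%nat - z ^ 0 * b 0%nat)%C with (z * b1 0%nat)%C by (simpl; ring).
  apply (Cseries_ext (fun i => z * (z ^ i * b (1 + i)%nat))%C).
  - intros i. simpl; ring.
  - apply Cseries_scal, S1. }
intros w Hw.
pose proof (Cseries_scal w _ _ (Hf1 w Hw)) as A1.
(* Dropping the first term of z f1(w) aligns the powers of w. By [Hrec], the difference w^(k+1)
   b1(k) - z w^(k+1) b1(k+1) is then the term of index k+1 of f(w). *)
pose proof (proj1 (Cseries_tail _ _) (Cseries_scal z _ _ (Hf1 w Hw))) as A2. cbv beta in A2.
pose proof (Cseries_minus _ _ _ _ A1 A2) as A3.
pose proof (proj1 (Cseries_tail _ _) (Hf w Hw)) as A4. cbv beta in A4.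
assert (E : (f w - w ^ 0 * b 0%nat = w * f1 w - (z * f1 w - z * (w ^ 0 * b1 0%nat)))%C).
{ apply (Cseries_unique _ _ _ A4). revert A3. apply Cseries_ext.
  intros k. cbv beta. rewrite (Hrec k). simpl. ring. }
simpl in E. rewrite Ez.
replace (f w) with (f w - 1 * b 0%nat + b 0%nat)%C by ring. rewrite E. ring.
Qed.

Lemma sums_to_cont (b : nat -> C) (f : C -> C) (z : C) : sums_to b f -> disk z -> Ccont f z.
Proof.
intros Hf Hz. destruct (sums_to_divide b f z Hf Hz) as [b1 [f1 [H1 [_ E]]]].
unfold disk in Hz. pose proof (Cmod_ge_0 z) as Hz0.
destruct (sums_to_bounded b1 f1 ((1 + Cmod z) / 2) H1 ltac:(lra)) as [B HB].
apply (Ccont_lip f z B ((1 - Cmod z) / 2)); [lra |]. intros w Hw.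
assert (Hw' : Cmod w <= (1 + Cmod z) / 2).
{ replace w with ((w - z) + z)%C by ring.
  apply Rle_trans with (1 := Cmod_triangle _ _). lra. }
rewrite E by (unfold disk; lra).
replace (f z + (w - z) * f1 w - f z)%C with (f1 w * (w - z))%C by ring.
rewrite Cmod_mult. apply Rmult_le_compat_r; [apply Cmod_ge_0 | apply HB, Hw'].
Qed.

Lemma near_disk (z : C) : disk z -> near z disk.
Proof. intros Hz. apply (Rcont_lt (fun w => Cmod w)); [apply Rcont_Cmod, Ccont_id | exact Hz]. Qed.

Lemma sums_to_jet2 (b : nat -> C) (f : C -> C) (z : C) :
  sums_to b f -> disk z -> exists a, jet2 f z a.
Proof.
intros Hf Hz. destruct (sums_to_divide b f z Hf Hz) as [b1 [f1 [H1 [_ E1]]]].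
destruct (sums_to_divide b1 f1 z H1 Hz) as [b2 [f2 [H2 [_ E2]]]].
exists (f1 z), f2. split; [apply (sums_to_cont b2); assumption |].
generalize (near_disk z Hz). apply filter_imp. intros w Hw.
rewrite <- E2 by exact Hw. apply E1, Hw.
Qed.

Lemma disk_0 : disk 0%C.
Proof. unfold disk. rewrite Cmod_0. lra. Qed.

Lemma sums_to_at_0 (b : nat -> C) (f : C -> C) : sums_to b f -> f 0%C = b 0%nat.
Proof.
intros Hf. apply (Cseries_unique _ _ _ (Hf _ disk_0)).
apply Cseries_tail. replace (b 0%nat - 0 ^ 0 * b 0%nat)%C with (0 * 0)%C by (simpl; ring).
apply (Cseries_ext (fun k => 0 * (0 ^ k * b k))%C); [intros k; simpl; ring |].
destruct (tame_ex_sum b 0%C (sums_to_tame b f Hf) disk_0) as [l Hl].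
replace (0 * 0)%C with (0 * l)%C by ring. apply Cseries_scal, Hl.
Qed.

(** Division at the point 0 only shifts the coefficients, so each step of the induction extracts one
    factor [w]. The radius 1/2 is arbitrary; any radius below 1 would give a bound. *)
Lemma sums_to_order (n : nat) (b : nat -> C) (f : C -> C) : sums_to b f ->
  (forall k, (k < n)%nat -> b k = 0%C) ->
  exists K, forall w, Cmod w <= / 2 -> Cmod (f w) <= K * Cmod w ^ n.
Proof.
revert b f. induction n as [| n IH]; intros b f Hf Hb.
- destruct (sums_to_bounded b f (/ 2) Hf ltac:(lra)) as [B HB].
  exists B. intros w Hw. simpl. rewrite Rmult_1_r. apply HB, Hw.
- destruct (sums_to_divide b f 0%C Hf disk_0) as [b1 [f1 [H1 [R1 E1]]]].
  destruct (IH b1 f1 H1) as [K HK].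
  { intros k Hk. rewrite R1, Hb by lia. ring. }
  exists K. intros w Hw.
  rewrite E1 by (unfold disk; lra). rewrite (sums_to_at_0 b f Hf), Hb by lia.
  replace (0 + (w - 0) * f1 w)%C with (w * f1 w)%C by ring.
  rewrite Cmod_mult. pose proof (HK w Hw). pose proof (Cmod_ge_0 w). simpl. nra.
Qed.

(** * Translating [C_derive] and [Hclass] into expansions and power series *)

Lemma C_derive_jet2 (f : C -> C) (z a : C) : jet2 f z a -> C_derive f z = a.
Proof.
intros [g [Hg E]]. apply is_C_lim_unique.
pose (h := fun w => (a + (w - z) * g w)%C).
assert (Hh : Ccont h z) by (unfold h; ccont).
apply (filterlim_ext_loc h).
- unfold locally', within.
  generalize E. apply filter_imp. intros w Ew Hwz.
  rewrite Ew. unfold h. Cfield. intros E0. apply Hwz.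
  replace w with ((w - z) + z)%C by Cring. rewrite E0. Cring.
- intros P HP. specialize (Hh P). unfold filtermap in *.
  assert (Eh : h z = a) by (unfold h; ring).
  rewrite Eh in Hh. specialize (Hh HP).
  unfold locally', within. generalize Hh. apply filter_imp. auto.
Qed.

Lemma Hclass_sums_to (a : C) (n : nat) (q : C -> C) : Hclass a n q ->
  exists b, sums_to b q /\ b 0%nat = a /\ forall k, (0 < k < n)%nat -> b k = 0%C.
Proof.
intros [_ [b [H0 [Hk Hs]]]]. exists b. split; [| split; assumption].
intros w Hw. specialize (Hs w Hw). unfold is_pseries in Hs. revert Hs.
apply Cseries_ext. intros k. change (pow_n (K:=C_Ring) w k * b k = w ^ k * b k)%C.
reflexivity.
Qed.

Lemma Hclass_order (a : C) (n : nat) (q : C -> C) : (0 < n)%nat -> Hclass a n q ->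
  q 0%C = a /\ exists K, forall w, Cmod w <= / 2 -> Cmod (q w - a) <= K * Cmod w ^ n.
Proof.
intros Hn Hq. destruct (Hclass_sums_to a n q Hq) as [b [Hf [H0 Hb]]].
pose proof (sums_to_at_0 b q Hf) as E0. rewrite H0 in E0. split; [exact E0 |].
destruct (sums_to_divide b q 0%C Hf disk_0) as [b1 [f1 [H1 [R1 E1]]]].
(* One division has removed the constant coefficient [a] and shifted the others by one, so the
   quotient vanishes to order n - 1 and the explicit factor [w] restores the order n. *)
destruct (sums_to_order (pred n) b1 f1 H1) as [K HK].
{ intros k Hk. rewrite R1, Hb by lia. ring. }
exists K. intros w Hw. rewrite E1, E0 by (unfold disk; lra).
replace (a + (w - 0) * f1 w - a)%C with (w * f1 w)%C by ring.
destruct n as [| n]; [lia |]. simpl in HK |- *.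
rewrite Cmod_mult. pose proof (HK w Hw). pose proof (Cmod_ge_0 w). nra.
Qed.

(** * The maximum principle *)

(** Heine-Borel in gauge form: each point of a square containing the disk has a size that works
    nearby, and compactness gives a common lower bound for the sizes in use. The parameter of [P]
    serves below either as a gap or, through its inverse, as a bound. *)
Lemma compact_uniform (r : R) (P : C -> R -> Prop) :
  (forall w d d', 0 < d' <= d -> P w d -> P w d') ->
  (forall z, exists d, 0 < d /\ near z (fun w => P w d)) ->
  exists d, 0 < d /\ forall w, Cmod w <= r -> P w d.
Proof.
intros Hmon Hloc.
assert (H : forall x y, exists d : posreal, forall w : C,
  Rabs (Re w - x) < d -> Rabs (Im w - y) < d -> P w d).
{ intros x y. destruct (Hloc (x, y)) as [d [Hd [e He]]].
  assert (Hm : 0 < Rmin d e) by (apply Rmin_pos; [exact Hd | apply cond_pos]).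
  exists (mkposreal _ Hm). simpl. intros w H1 H2.
  pose proof (Rmin_l d e). pose proof (Rmin_r d e).
  apply (Hmon w d); [lra |]. apply He. split.
  - change (Rabs (Re w - x) < e). lra.
  - change (Rabs (Im w - y) < e). lra. }
pose (D := fun x y => proj1_sig (constructive_indefinite_description _ (H x y))).
assert (HD : forall x y w, Rabs (Re w - x) < D x y -> Rabs (Im w - y) < D x y -> P w (D x y)).
{ intros x y. exact (proj2_sig (constructive_indefinite_description _ (H x y))). }
destruct (compactness_value_2d (- r) r (- r) r D) as [d Hd].
exists d. split; [apply cond_pos |]. intros w Hw. apply NNPP. intros HN.
pose proof (re_le_Cmod w) as H1. pose proof (im_le_Cmod w) as H2.
assert (H1' : Rabs (Re w) <= r) by lra. assert (H2' : Rabs (Im w) <= r) by lra.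
apply Rabs_le_between in H1', H2'.
apply (Hd (Re w) (Im w) H1' H2'). intros [x [y [_ [_ [A1 [A2 A3]]]]]].
apply HN. apply (Hmon w (D x y)); [split; [apply cond_pos | exact A3] |].
apply HD; assumption.
Qed.

(** Compactness is used twice: first to bound [f] on [K], so that a supremum M exists, then to show
    that an unattained M could be lowered to M - d. Closedness of [K] is what lets points outside it
    satisfy the local conditions vacuously. *)
Lemma attains_max (r : R) (K : C -> Prop) (f : C -> R) :
  (forall z, K z -> Cmod z <= r) -> (forall z, ~ K z -> near z (fun w => ~ K w)) ->
  (exists z, K z) -> (forall z, K z -> Rcont f z) ->
  exists z, K z /\ forall w, K w -> f w <= f z.
Proof.
intros Hr Hc [z0 Hz0] Hf.
assert (HB : exists d, 0 < d /\ forall w, Cmod w <= r -> K w -> f w <= / d).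
{ apply (compact_uniform r (fun w d => K w -> f w <= / d)).
  - intros w d d' Hd H Hw. apply Rle_trans with (1 := H Hw). apply Rinv_le_contravar; lra.
  - intros z. destruct (classic (K z)) as [Hz | Hz].
    + pose proof (Rabs_pos (f z)) as Ha. exists (/ (Rabs (f z) + 1)).
      split; [apply Rinv_0_lt_compat; lra |]. rewrite Rinv_inv.
      pose proof (Rle_abs (f z)) as Hle.
      generalize (Rcont_lt f z (Rabs (f z) + 1) (Hf z Hz) ltac:(lra)). apply filter_imp.
      intros w Hw _. lra.
    + exists 1. split; [lra |]. generalize (Hc z Hz). apply filter_imp.
      intros w Hw Hk. contradiction. }
destruct HB as [b [Hb HB]].
destruct (completeness (fun x => exists w, K w /\ x = f w)) as [M [HM1 HM2]].
{ exists (/ b). intros x [w [Hw ->]]. apply HB; auto. }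
{ exists (f z0), z0. auto. }
assert (HM : forall w, K w -> f w <= M) by (intros w Hw; apply HM1; exists w; auto).
destruct (classic (exists z, K z /\ f z = M)) as [[z [Hz <-]] | HN]; [exists z; auto |].
exfalso.
assert (HS : exists d, 0 < d /\ forall w, Cmod w <= r -> K w -> f w <= M - d).
{ apply (compact_uniform r (fun w d => K w -> f w <= M - d)).
  - intros w d d' Hd H Hw. specialize (H Hw). lra.
  - intros z. destruct (classic (K z)) as [Hz | Hz].
    + assert (Hlt : f z < M).
      { destruct (HM z Hz) as [H | H]; [exact H |]. exfalso. apply HN. exists z. auto. }
      exists ((M - f z) / 2). split; [lra |].
      generalize (Rcont_lt f z ((M + f z) / 2) (Hf z Hz) ltac:(lra)). apply filter_imp.
      intros w Hw _. lra.
    + exists 1. split; [lra |]. generalize (Hc z Hz). apply filter_imp.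
      intros w Hw Hk. contradiction. }
destruct HS as [d [Hd HS]].
assert (M <= M - d); [| lra]. apply HM2. intros x [w [Hw ->]]. apply HS; auto.
Qed.

(* The mean of [|f|^2 + e |w|^2] over the four points [z + i^k s] exceeds the central
   value by [(|f'(z)|^2 + e) s^2 + o(s^2)], the first- and second-order terms cancelling. *)
Lemma jet2_not_local_max (f : C -> C) (z a : C) (e : R) : jet2 f z a -> 0 < e ->
  ~ near z (fun w => Cmod (f w) ^ 2 + e * Cmod w ^ 2 <= Cmod (f z) ^ 2 + e * Cmod z ^ 2).
Proof.
intros [g [Hg Ej]] He Hmax.
pose proof (Cmod_ge_0 (f z)) as F0. pose proof (Cmod_ge_0 a) as A0.
pose proof (Cmod_ge_0 (g z)) as G0.
set (B := Cmod (f z) + Cmod a + Cmod (g z) + 1).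
assert (HB : 0 < B) by (unfold B; lra).
(* [B] will bound the quadratic approximation X of f at distance s <= 1. The replaced remainder Y is
   then at most s^2 e / (4 B), so that 2 |X| |Y| <= e s^2 / 2, half of what the term e |w|^2
   gains. *)
assert (Heta : 0 < e / (4 * B)) by (apply Rdiv_lt_0_compat; lra).
assert (Hgn : near z (fun w => Cmod (g w - g z) < e / (4 * B))).
{ apply (Rcont_lt (fun w => Cmod (g w - g z))).
  - apply (Rcont_Cmod (fun w => g w - g z)%C). ccont.
  - replace (g z - g z)%C with (RtoC 0) by ring. rewrite Cmod_0. exact Heta. }
destruct (proj1 (near_Cmod _ _) (filter_and _ _ Hmax (filter_and _ _ Ej Hgn))) as [d Hd].
set (s := Rmin (d / 2) 1).
assert (Hs : 0 < s /\ s < d /\ s <= 1).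
{ pose proof (cond_pos d). unfold s. pose proof (Rmin_l (d / 2) 1).
  pose proof (Rmin_r (d / 2) 1). repeat split; [apply Rmin_pos | |]; lra. }
assert (Hpt : forall h : C, Cmod h = s ->
  Cmod (f z + a * h + g z * (h * h)) ^ 2 - e * s ^ 2 / 2 + e * Cmod (z + h) ^ 2
    <= Cmod (f z) ^ 2 + e * Cmod z ^ 2).
{ intros h Hh. destruct (Hd (z + h)%C) as [H1 [H2 H3]].
  { replace (z + h - z)%C with h by ring. lra. }
  set (X := (f z + a * h + g z * (h * h))%C).
  set (Y := (h * h * (g (z + h) - g z))%C).
  assert (EX : f (z + h)%C = (X + Y)%C) by (rewrite H2; unfold X, Y; ring).
  assert (HY : Cmod Y <= s ^ 2 * (e / (4 * B))).
  { unfold Y. rewrite !Cmod_mult, Hh. simpl. rewrite Rmult_1_r.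
    apply Rmult_le_compat_l; nra. }
  assert (HX : Cmod X <= B).
  { unfold X, B. apply Rle_trans with (1 := Cmod_triangle _ _).
    pose proof (Cmod_triangle (f z) (a * h)) as T.
    assert (Cmod (a * h) <= Cmod a) by (rewrite Cmod_mult, Hh; nra).
    assert (s * s <= 1) by nra.
    assert (Cmod (g z * (h * h)) <= Cmod (g z)) by (rewrite !Cmod_mult, Hh; nra).
    lra. }
  assert (HXY : Cmod X <= Cmod (f (z + h)%C) + Cmod Y).
  { replace X with (f (z + h)%C + - Y)%C by (rewrite EX; ring).
    apply Rle_trans with (1 := Cmod_triangle _ _). rewrite Cmod_opp. lra. }
  pose proof (Cmod_ge_0 X). pose proof (Cmod_ge_0 Y). pose proof (Cmod_ge_0 (f (z + h)%C)).
  assert (HXY2 : Cmod X ^ 2 - 2 * Cmod X * Cmod Y <= Cmod (f (z + h)%C) ^ 2).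
  { destruct (Rle_lt_dec (Cmod X) (Cmod Y)); nra. }
  assert (Cmod X * Cmod Y <= B * (s ^ 2 * (e / (4 * B))))
    by (apply Rmult_le_compat; assumption).
  assert (B * (s ^ 2 * (e / (4 * B))) = e * s ^ 2 / 4) by (field; lra).
  lra. }
assert (Cs : forall x y : R, x ^ 2 + y ^ 2 = s ^ 2 -> Cmod (x, y) = s).
{ intros x y E. unfold Cmod; cbn [fst snd]. rewrite E. apply sqrt_pow2. lra. }
pose proof (Hpt (s, 0) (Cs s 0 ltac:(ring))) as P1.
pose proof (Hpt (- s, 0) (Cs (- s) 0 ltac:(ring))) as P2.
pose proof (Hpt (0, s) (Cs 0 s ltac:(ring))) as P3.
pose proof (Hpt (0, - s) (Cs 0 (- s) ltac:(ring))) as P4.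
rewrite !Cmod2_alt in P1, P2, P3, P4.
destruct z as [zx zy], (f (zx, zy)) as [fx fy], a as [ax ay], (g (zx, zy)) as [gx gy].
unfold Cplus, Cmult in P1, P2, P3, P4; cbn [Re Im fst snd] in P1, P2, P3, P4.
(* Adding [P1] to [P4] leaves 4 (|a|^2 s^2 + |g z|^2 s^4) + 4 e s^2 - 2 e s^2 <= 0, which is
   absurd. *)
assert (0 <= (ax ^ 2 + ay ^ 2) * s ^ 2 + (gx ^ 2 + gy ^ 2) * s ^ 4) by nra.
assert (0 < e * s ^ 2) by (apply Rmult_lt_0_compat; [| apply pow_lt]; lra).
nra.
Qed.

(** The perturbed function |f|^2 + e |w|^2 attains its maximum on the closed disk. An interior
    maximum away from 0 is excluded by the expansion there, and one at 0 by f(0) = 0; the origin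
    thus requires continuity only. *)
Lemma max_modulus (f : C -> C) (r m : R) : 0 < r -> 0 <= m ->
  (forall z, Cmod z <= r -> Ccont f z) -> f 0%C = 0%C ->
  (forall z, 0 < Cmod z < r -> exists a, jet2 f z a) ->
  (forall z, Cmod z = r -> Cmod (f z) <= m) ->
  forall z, Cmod z <= r -> Cmod (f z) <= m.
Proof.
intros Hr Hm Hc H0 Hj Hb z Hz.
apply Rnot_lt_le. intros Hlt.
(* With e r^2 equal to half the excess of |f z|^2 over m^2, a maximum on the circle would still be
   below the value at [z]. *)
set (e := (Cmod (f z) ^ 2 - m ^ 2) / (2 * r ^ 2)).
assert (Hr2 : 0 < r ^ 2) by (apply pow_lt; lra).
assert (He : 0 < e) by (apply Rdiv_lt_0_compat; nra).
assert (Her : e * r ^ 2 = (Cmod (f z) ^ 2 - m ^ 2) / 2) by (unfold e; field; lra).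
destruct (attains_max r (fun w => Cmod w <= r)
  (fun w => Cmod (f w) ^ 2 + e * Cmod w ^ 2)) as [w [Hw Hmax]].
- auto.
- intros w Hw. generalize (Rcont_gt (fun w => Cmod w) w r (Rcont_Cmod _ _ (Ccont_id w)) ltac:(lra)).
  apply filter_imp. intros; lra.
- exists z. exact Hz.
- intros w Hw.
  assert (Cf : Rcont (fun w => Cmod (f w)) w) by (apply Rcont_Cmod, Hc, Hw).
  assert (Ci : Rcont (fun w => Cmod w) w) by (apply Rcont_Cmod, Ccont_id).
  apply (continuous_ext (fun w => Cmod (f w) * Cmod (f w) + e * (Cmod w * Cmod w))).
  { intros t. eqR. ring. }
  apply (continuous_plus (V:=R_NormedModule)); [apply (continuous_mult (K:=R_AbsRing)); assumption |].
  apply (continuous_mult (K:=R_AbsRing)); [apply continuous_const |].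
  apply (continuous_mult (K:=R_AbsRing)); assumption.
- pose proof (Hmax z Hz) as Mz. cbv beta in Mz, Hw.
  pose proof (Cmod_ge_0 z) as Z0. pose proof (Cmod_ge_0 w) as W0.
  destruct (Req_dec (Cmod w) r) as [E | N].
  + pose proof (Hb w E). pose proof (Cmod_ge_0 (f w)). rewrite E in Mz. nra.
  + destruct (Req_dec (Cmod w) 0) as [E | N'].
    * apply Cmod_eq_0 in E. subst w. rewrite H0, Cmod_0 in Mz. nra.
    * destruct (Hj w ltac:(lra)) as [a Ja].
      apply (jet2_not_local_max f w a e Ja He).
      generalize (Rcont_lt (fun w => Cmod w) w r (Rcont_Cmod _ _ (Ccont_id w)) ltac:(lra)).
      apply filter_imp. intros t Ht. apply Hmax. lra.
Qed.

(** * Schwarz and Jack lemmas *)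

Lemma le_1_of_pow_bounded (x K : R) : 0 <= x -> (forall N, x ^ S N <= K) -> x <= 1.
Proof.
intros Hx H. apply Rnot_lt_le. intros Hlt.
destruct (Pow_x_infinity x ltac:(rewrite Rabs_pos_eq; lra) (K + 1)) as [N HN].
specialize (HN (S N) ltac:(lia)). rewrite Rabs_pos_eq in HN by (apply pow_le, Hx).
specialize (H N). lra.
Qed.

(* [phi^N / z^(n N - 1)] vanishes at 0 and is continuous there, so the maximum principle
   applies to it without any discussion of removable singularities.  Taking [N]-th roots
   gives the sharp bound in the limit. *)
Lemma schwarz_on_smaller_disk (phi : C -> C) (n : nat) (r K d : R) : (0 < n)%nat -> 0 < r -> 0 < d ->
  (forall z, Cmod z <= r -> exists a, jet2 phi z a) ->
  (forall z, Cmod z <= r -> Cmod (phi z) <= 1) ->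
  (forall z, Cmod z < d -> Cmod (phi z) <= K * Cmod z ^ n) ->
  forall z, Cmod z <= r -> Cmod (phi z) * r ^ n <= Cmod z ^ n.
Proof.
intros Hn Hr Hd Hj H1 HK z Hz.
assert (HK0 : 0 <= K).
{ assert (E : Cmod (d / 2) = d / 2).
  { rewrite <- RtoC_div, Cmod_R by lra. apply Rabs_pos_eq; lra. }
  pose proof (HK (d / 2)%C ltac:(lra)) as H. rewrite E in H.
  pose proof (Cmod_ge_0 (phi (d / 2)%C)). pose proof (pow_lt (d / 2) n ltac:(lra)). nra. }
assert (P0 : phi 0%C = 0%C).
{ apply Cmod_eq_0. pose proof (HK 0%C ltac:(rewrite Cmod_0; exact Hd)) as H.
  rewrite Cmod_0, pow_i in H by lia. pose proof (Cmod_ge_0 (phi 0%C)). lra. }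
destruct (Req_dec (Cmod z) 0) as [Ez | Nz].
{ apply Cmod_eq_0 in Ez. rewrite Ez, P0, Cmod_0, pow_i by lia. lra. }
pose proof (Cmod_ge_0 z) as Z0. pose proof (pow_lt r n Hr) as Hrn.
pose proof (pow_lt (Cmod z) n ltac:(lra)) as Hzn.
set (x := Cmod (phi z) * r ^ n / Cmod z ^ n).
enough (x <= 1) as Hx.
{ unfold x in Hx. apply Rle_div_l in Hx; [| exact Hzn]. lra. }
(* The exponent of z in the auxiliary quotient is one short of n (N+1). The missing factor costs r /
   |z|, a bound that does not depend on N. *)
apply (le_1_of_pow_bounded x (r / Cmod z)).
{ apply Rdiv_le_0_compat; [| exact Hzn]. pose proof (Cmod_ge_0 (phi z)). nra. }
(* This is n (N+1) - 1 written without subtraction. Since phi^(N+1) is of order n (N+1), one factor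
   |w| survives and makes the quotient Lipschitz at 0. *)
intros N. pose (k := (N + (pred n) * S N)%nat).
assert (Hk : S k = (n * S N)%nat) by (unfold k; destruct n; [lia | simpl; lia]).
pose (f := fun w : C => (phi w ^ S N * (/ w) ^ k)%C).
assert (Ef : forall w : C, w <> 0%C -> Cmod (f w) = Cmod (phi w) ^ S N * / Cmod w ^ k).
{ intros w Hw. unfold f. rewrite Cmod_mult, !Cmod_pow, Cmod_inv by exact Hw.
  rewrite pow_inv. reflexivity. }
assert (F0 : f 0%C = 0%C) by (unfold f; rewrite P0; simpl; ring).
assert (Jf : forall w, 0 < Cmod w <= r -> exists a, jet2 f w a).
{ intros w Hw. destruct (Hj w ltac:(lra)) as [a Ja].
  destruct (jet2_pow phi w a (S N) Ja) as [b Jb].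
  destruct (jet2_pow (fun w => / w)%C w _ k (jet2_Cinv w ltac:(apply Cmod_gt_0; lra))) as [c Jc].
  eexists. apply (jet2_mult _ _ _ _ _ Jb Jc). }
assert (Hf : Cmod (f z) <= / r ^ k).
{ apply (max_modulus f r); [exact Hr | | | exact F0 | | | exact Hz].
  - left. apply Rinv_0_lt_compat, pow_lt, Hr.
  - intros w Hw. destruct (Req_dec (Cmod w) 0) as [E | Nw].
    + apply Cmod_eq_0 in E. subst w. apply (Ccont_lip f 0 (K ^ S N) d Hd). intros w Hw'.
      rewrite F0. replace (w - 0)%C with w in * by ring. replace (f w - 0)%C with (f w) by ring.
      destruct (Req_dec (Cmod w) 0) as [E | Nw].
      * apply Cmod_eq_0 in E. subst w. rewrite F0, Cmod_0. lra.
      * pose proof (Cmod_ge_0 w) as W0. pose proof (pow_lt (Cmod w) k ltac:(lra)) as Hwk.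
        rewrite Ef by (apply Cmod_gt_0; lra).
        apply Rle_div_l; [exact Hwk |].
        rewrite Rmult_assoc. change (Cmod w * Cmod w ^ k) with (Cmod w ^ S k).
        rewrite Hk, pow_mult, <- Rpow_mult_distr.
        apply pow_incr. split; [apply Cmod_ge_0 | apply HK, Hw'].
    + pose proof (Cmod_ge_0 w). destruct (Jf w ltac:(lra)) as [a Ja].
      apply (jet2_cont _ _ _ Ja).
  - intros w Hw. apply Jf. lra.
  - intros w Hw. rewrite Ef by (apply Cmod_gt_0; lra). rewrite Hw.
    pose proof (Rinv_0_lt_compat _ (pow_lt r k Hr)).
    assert (Cmod (phi w) ^ S N <= 1); [| nra].
    rewrite <- (pow1 (S N)). apply pow_incr. split; [apply Cmod_ge_0 | apply H1; lra]. }
rewrite Ef in Hf by (apply Cmod_gt_0; lra).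
pose proof (pow_lt r k Hr) as Hrk. pose proof (pow_lt (Cmod z) k ltac:(lra)) as Hzk.
unfold x, Rdiv. rewrite !Rpow_mult_distr, pow_inv, <- !pow_mult, <- !Hk.
change (r ^ S k) with (r * r ^ k). change (Cmod z ^ S k) with (Cmod z * Cmod z ^ k).
set (y := Cmod (phi z) ^ S N) in *.
assert (y * / Cmod z ^ k * r ^ k <= 1).
{ apply (Rmult_le_compat_r (r ^ k)) in Hf; [| lra]. rewrite Rinv_l in Hf by lra. exact Hf. }
replace (y * (r * r ^ k) * / (Cmod z * Cmod z ^ k))
  with (y * / Cmod z ^ k * r ^ k * (r * / Cmod z)) by (field; lra).
assert (0 < r * / Cmod z) by (apply Rdiv_lt_0_compat; lra). nra.
Qed.

(** The radius of the closed-disk version is increased to [r] by continuity of s^n. Only the open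
    disk may be assumed, because on the circle through the exit point [q] is not known to stay in
    the sector. *)
Lemma schwarz (phi : C -> C) (n : nat) (r K d : R) : (0 < n)%nat -> 0 < d ->
  (forall z, Cmod z < r -> exists a, jet2 phi z a) ->
  (forall z, Cmod z < r -> Cmod (phi z) <= 1) ->
  (forall z, Cmod z < d -> Cmod (phi z) <= K * Cmod z ^ n) ->
  forall z, Cmod z < r -> Cmod (phi z) * r ^ n <= Cmod z ^ n.
Proof.
intros Hn Hd Hj H1 HK z Hz. apply Rnot_lt_le. intros Hlt.
pose (u := fun s => Cmod (phi z) * s ^ n).
assert (Hu : continuous u r).
{ apply (ex_derive_continuous (K:=R_AbsRing) (V:=R_NormedModule) u r). unfold u. auto_derive. easy. }
destruct (Hu _ (open_gt (Cmod z ^ n) (u r) Hlt)) as [e He].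
set (s := Rmax (r - e / 2) ((r + Cmod z) / 2)).
pose proof (cond_pos e). pose proof (Cmod_ge_0 z).
assert (Hs : r - e < s < r /\ Cmod z < s).
{ unfold s. pose proof (Rmax_l (r - e / 2) ((r + Cmod z) / 2)).
  pose proof (Rmax_r (r - e / 2) ((r + Cmod z) / 2)).
  repeat split; [lra | apply Rmax_lub_lt; lra | lra]. }
assert (Cmod z ^ n < u s).
{ apply He. change (Rabs (s - r) < e). apply Rabs_lt_between. lra. }
pose proof (schwarz_on_smaller_disk phi n s K d Hn ltac:(lra) Hd) as S.
specialize (S (fun w Hw => Hj w ltac:(lra)) (fun w Hw => H1 w ltac:(lra)) HK z ltac:(lra)).
unfold u in *. lra.
Qed.

(** Put xi = z0 chi'(z0) / chi(z0). For Re v < 0 the points z0 (1 + t v) with small t > 0 lie inside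
    the disk, where chi = chi(z0) (1 + t xi v + O(t^2)) has modulus at most 1; hence Re (xi v) <= 0.
    Such an inequality on the whole left half-plane forces xi to be real and nonnegative. *)
Lemma boundary_max_derivative (chi : C -> C) (z0 a : C) : z0 <> 0%C ->
  jet2 chi z0 a -> Cmod (chi z0) = 1 ->
  (forall z, Cmod z < Cmod z0 -> Cmod (chi z) <= 1) ->
  Im (z0 * a / chi z0) = 0 /\ 0 <= Re (z0 * a / chi z0).
Proof.
intros Hz0 [g [Hg Ej]] Hc Hle.
pose proof (proj1 (Cmod_gt_0 z0) Hz0) as Hm.
assert (Hc0 : chi z0 <> 0%C) by (apply Cmod_gt_0; lra).
set (xi := (z0 * a / chi z0)%C).
assert (Key : forall v : C, Re v < 0 -> Re (xi * v) <= 0).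
{ intros v Hv. apply Rnot_lt_le. intros Hpos.
  assert (Hgn : near z0 (fun w => Cmod (g w) < Cmod (g z0) + 1)).
  { apply (Rcont_lt (fun w => Cmod (g w))); [apply (Rcont_Cmod g _ Hg) | lra]. }
  destruct (proj1 (near_Cmod _ _) (filter_and _ _ Ej Hgn)) as [d Hd].
  pose proof (Cmod_ge_0 v) as V0. pose proof (Cmod_ge_0 (g z0)) as G0.
  pose proof (Rle_trans _ _ _ (Rle_abs (- Re v)) (Req_le _ _ (Rabs_Ropp (Re v)))) as V1.
  pose proof (re_le_Cmod v) as V2. assert (Vp : 0 < Cmod v) by lra.
  set (M := Cmod z0 ^ 2 * Cmod v ^ 2 * (Cmod (g z0) + 1) + 1).
  assert (HM : 0 < M) by (unfold M; pose proof (pow_lt _ 2 Hm); pose proof (pow_lt _ 2 Vp); nra).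
  (* The three bounds keep the point where the expansion holds, make |1 + t v| < 1, and keep the
     quadratic error t^2 M at no more than half of the linear gain t Re (xi v). *)
  set (t := Rmin (d / (2 * (Cmod z0 * Cmod v))) (Rmin (- Re v / Cmod v ^ 2) (Re (xi * v) / (2 * M)))).
  assert (Ht : 0 < t /\ t <= d / (2 * (Cmod z0 * Cmod v)) /\ t <= - Re v / Cmod v ^ 2 /\
    t <= Re (xi * v) / (2 * M)).
  { pose proof (cond_pos d). assert (0 < Cmod z0 * Cmod v) by nra.
    unfold t. repeat split.
    - repeat apply Rmin_pos; apply Rdiv_lt_0_compat; try lra. apply pow_lt, Vp.
    - apply Rmin_l.
    - apply Rle_trans with (1 := Rmin_r _ _). apply Rmin_l.
    - apply Rle_trans with (1 := Rmin_r _ _). apply Rmin_r. }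
  destruct Ht as [T0 [T1 [T2 T3]]].
  apply Rle_div_r in T1; [| nra]. apply Rle_div_r in T2; [| apply pow_lt, Vp].
  apply Rle_div_r in T3; [| lra].
  set (w := (z0 * (1 + t * v))%C).
  assert (Ew : (w - z0 = t * (z0 * v))%C) by (unfold w; ring).
  assert (Hwd : Cmod (w - z0) < d).
  { rewrite Ew, !Cmod_mult, Cmod_R, Rabs_pos_eq by lra. pose proof (cond_pos d). lra. }
  assert (Hw : Cmod w < Cmod z0).
  { unfold w. rewrite Cmod_mult.
    assert (Cmod (1 + t * v) < 1); [| nra].
    apply Rsqr_incrst_0; [| apply Cmod_ge_0 | lra].
    rewrite !Rsqr_pow2, Cmod2_alt. rewrite Cmod2_alt in T2.
    destruct v as [vx vy]. unfold RtoC, Cplus, Cmult; cbn [Re Im fst snd] in *. nra. }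
  destruct (Hd w Hwd) as [E1 E2].
  assert (E3 : chi w = (chi z0 * ((1 + t * (xi * v))
    + t * t * (z0 * v * (z0 * v) * g w) / chi z0))%C).
  { rewrite E1, Ew. unfold xi. field. exact Hc0. }
  pose proof (Hle w Hw) as L. rewrite E3, Cmod_mult, Hc, Rmult_1_l in L.
  set (Y := (t * t * (z0 * v * (z0 * v) * g w) / chi z0)%C) in *.
  assert (HY : Cmod Y <= t * t * M).
  { unfold Y. rewrite Cmod_div, Hc, !Cmod_mult, !Cmod_R, Rabs_pos_eq by (try exact Hc0; lra).
    unfold Rdiv. rewrite Rinv_1, Rmult_1_r.
    apply Rmult_le_compat_l; [nra |]. unfold M.
    replace (Cmod z0 * Cmod v * (Cmod z0 * Cmod v) * Cmod (g w))
      with (Cmod z0 ^ 2 * Cmod v ^ 2 * Cmod (g w)) by ring.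
    assert (Cmod z0 ^ 2 * Cmod v ^ 2 * Cmod (g w)
      <= Cmod z0 ^ 2 * Cmod v ^ 2 * (Cmod (g z0) + 1)); [| lra].
    apply Rmult_le_compat_l; [| lra]. pose proof (pow2_ge_0 (Cmod z0 * Cmod v)). nra. }
  assert (L1 : Re (1 + t * (xi * v)) <= 1 + Cmod Y).
  { apply Rle_trans with (1 := Rle_abs _). apply Rle_trans with (1 := re_le_Cmod _).
    replace (1 + t * (xi * v))%C with ((1 + t * (xi * v) + Y) + - Y)%C by ring.
    apply Rle_trans with (1 := Cmod_triangle _ _). rewrite Cmod_opp. lra. }
  assert (L2 : Re (1 + t * (xi * v)) = 1 + t * Re (xi * v)).
  { destruct (xi * v)%C as [p q]. unfold RtoC, Cplus, Cmult; cbn [Re Im fst snd]. ring. }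
  rewrite L2 in L1. nra. }
(* The directions v = -1 + i y suffice. If Im xi were nonzero, some y would make the left side equal
   to 1. *)
assert (Ky : forall y, - Re xi - y * Im xi <= 0).
{ intros y. pose proof (Key (-1, y) ltac:(cbn; lra)) as H.
  destruct xi as [p q]. unfold Cmult in H; cbn [Re Im fst snd] in *. lra. }
split.
- destruct (Req_dec (Im xi) 0) as [E | N]; [exact E |].
  pose proof (Ky (- (Re xi + 1) / Im xi)) as H.
  replace (- Re xi - - (Re xi + 1) / Im xi * Im xi) with 1 in H by (field; exact N). lra.
- pose proof (Ky 0). lra.
Qed.

Lemma jet2_pow_inv (z : C) (n : nat) : z <> 0%C ->
  jet2 (fun w => (/ w) ^ n)%C z (- INR n * (/ z) ^ n * / z)%C.
Proof.
intros Hz. induction n as [| n IH].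
- simpl. replace (- 0 * 1 * / z)%C with (RtoC 0) by ring. apply jet2_const.
- rewrite S_INR, RtoC_plus.
  replace (- (INR n + 1) * (/ z) ^ S n * / z)%C
    with (- / (z * z) * (/ z) ^ n + / z * (- INR n * (/ z) ^ n * / z))%C
    by (simpl; field; exact Hz).
  apply (jet2_mult (fun w => / w)%C); [apply jet2_Cinv, Hz | exact IH].
Qed.

(* The boundary Schwarz (Jack) lemma, obtained by applying the case of exponent 0 to
   [phi(z) (z0 / z)^n]. *)
Lemma jack (phi : C -> C) (z0 a : C) (n : nat) : z0 <> 0%C -> (0 < n)%nat ->
  jet2 phi z0 a -> Cmod (phi z0) = 1 ->
  (forall z, Cmod z < Cmod z0 -> Cmod (phi z) * Cmod z0 ^ n <= Cmod z ^ n) ->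
  Im (z0 * a / phi z0) = 0 /\ INR n <= Re (z0 * a / phi z0).
Proof.
intros Hz0 Hn Ja Hp Hle.
assert (Hp0 : phi z0 <> 0%C) by (apply Cmod_gt_0; lra).
pose proof (proj1 (Cmod_gt_0 z0) Hz0) as Hm.
pose proof (jet2_mult _ _ _ _ _ (jet2_mult _ _ _ _ _ (jet2_const (z0 ^ n)%C z0) Ja)
  (jet2_pow_inv z0 n Hz0)) as J. cbv beta in J.
assert (Enz : (z0 ^ n * (/ z0) ^ n = 1)%C).
{ rewrite <- Cpow_mult_l, Cinv_r by exact Hz0. apply Cpow_1_l. }
destruct (boundary_max_derivative _ z0 _ Hz0 J) as [H1 H2].
- replace (z0 ^ n * phi z0 * (/ z0) ^ n)%C with (phi z0 * (z0 ^ n * (/ z0) ^ n))%C by ring.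
  rewrite Enz, Cmult_1_r. exact Hp.
- intros z Hz. destruct (Req_dec (Cmod z) 0) as [E | N].
  (* At z = 0 the inverse takes a default value, but [Hle] forces phi(0) = 0, so the product
     vanishes whatever that value is. *)
  + rewrite !Cmod_mult. pose proof (Hle z Hz) as L. rewrite E, pow_i in L by exact Hn.
    pose proof (pow_lt _ n Hm). pose proof (Cmod_ge_0 (phi z)).
    assert (E0 : Cmod (phi z) = 0) by nra. rewrite E0. lra.
  + pose proof (Cmod_ge_0 z). assert (z <> 0%C) by (apply Cmod_gt_0; lra).
    rewrite !Cmod_mult, !Cmod_pow, Cmod_inv, pow_inv by assumption.
    apply Rle_div_l; [apply pow_lt; lra |]. rewrite (Rmult_comm (Cmod z0 ^ n)), Rmult_1_l.
    apply Hle, Hz.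
- assert (E : (z0 * ((0 * phi z0 + z0 ^ n * a) * (/ z0) ^ n
    + z0 ^ n * phi z0 * (- INR n * (/ z0) ^ n * / z0)) / (z0 ^ n * phi z0 * (/ z0) ^ n)
    = z0 * a / phi z0 - INR n)%C).
  { pose proof (Cpow_nz z0 n Hz0). rewrite Cpow_inv by exact Hz0. field. auto. }
  rewrite E in H1, H2.
  destruct (z0 * a / phi z0)%C as [p q].
  unfold Cminus, Cplus, Copp, RtoC in H1, H2; cbn [Re Im fst snd] in *. lra.
Qed.

(** * A one-variable minimisation that yields the half-width of the strip *)

Lemma is_derive_Rpower (a x : R) : 0 < x ->
  is_derive (fun x => Rpower x a) x (a * Rpower x a / x).
Proof.
intros Hx. unfold Rpower. auto_derive; [exact Hx |]. field. lra.
Qed.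

(* The minimum over [x] is at the critical point [x0], where [A x0^(alpha+1) = 1 - x0^2];
   this forces [x0 <= 1 / sqrt (1 + A)], and the minimum decreases with [x0]. *)
Lemma weighted_sum_ge (alpha A x : R) : 0 < alpha <= 1 -> 0 < A -> 0 < x ->
  (alpha - 1) / sqrt (1 + A) + (alpha + 1) * sqrt (1 + A)
    <= A * Rpower x alpha + alpha * (x + / x).
Proof.
intros Ha HA Hx.
(* The right-hand side has derivative alpha k(x) / x^2. As [k] is increasing, its zero is the global
   minimum point. *)
pose (k := fun x => A * Rpower x alpha * x + x ^ 2 - 1).
assert (Hpos : forall y, 0 < Rpower y alpha) by (intros y; apply exp_pos).
assert (Hmon : forall y z, 0 < y <= z -> k y <= k z).
{ intros y z Hyz. unfold k.
  assert (Rpower y alpha <= Rpower z alpha) by (apply Rle_Rpower_l; lra).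
  pose proof (Hpos y).
  assert (A * Rpower y alpha <= A * Rpower z alpha) by nra.
  assert (A * Rpower y alpha * y <= A * Rpower z alpha * z)
    by (apply Rmult_le_compat; nra). nra. }
(* A left endpoint with k(a) < 0: since a < 1, k(a) <= A a + a - 1 = -1/2. *)
pose (a := / (2 * (1 + A))).
assert (Ea : a * (2 * (1 + A)) = 1) by (unfold a; field; lra).
assert (Ha1 : 0 < a < 1) by (split; nra).
assert (Hle : forall y, 0 < y <= 1 -> y <= Rpower y alpha <= 1).
{ intros y Hy. split.
  - rewrite <- (exp_ln y) at 1 by lra. unfold Rpower.
    assert (ln y <= 0).
    { rewrite <- ln_1. destruct (Req_dec y 1) as [-> | N]; [lra |]. left. apply ln_increasing; lra. }
    destruct (Req_dec (ln y) (alpha * ln y)) as [E | N]; [rewrite <- E; lra |].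
    left. apply exp_increasing. nra.
  - replace 1 with (Rpower 1 alpha) by (unfold Rpower; rewrite ln_1, Rmult_0_r; apply exp_0).
    apply Rle_Rpower_l; lra. }
destruct (Ranalysis5.IVT_interv k a 1) as [x0 [Hx0 E0]].
{ intros y Hy. apply derivable_continuous_pt.
  eexists. apply is_derive_Reals. unfold k, Rpower.
  auto_derive; [lra | reflexivity]. }
{ lra. }
{ unfold k. pose proof (Hle a ltac:(lra)). pose proof (Hpos a).
  assert (0 <= A * a * (1 - Rpower a alpha)) by (apply Rmult_le_pos; nra).
  assert (0 <= a * (1 - a)) by nra. lra. }
{ unfold k. pose proof (Hpos 1). nra. }
set (G := fun x => A * Rpower x alpha + alpha * (x + / x)).
assert (HG : G x0 <= G x).
{ destruct (MVT_gen G x0 x (fun y => alpha * k y / y ^ 2)) as [y [Hy EG]].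
  - intros y Hy. assert (0 < y) by (apply Rlt_trans with (2 := proj1 Hy), Rmin_pos; lra).
    unfold G, k.
    replace (alpha * (A * Rpower y alpha * y + y ^ 2 - 1) / y ^ 2)
      with (A * (alpha * Rpower y alpha / y) + alpha * (1 - / y ^ 2)) by (field; lra).
    apply (is_derive_plus (K:=R_AbsRing) (V:=R_NormedModule)).
    + apply is_derive_scal, is_derive_Rpower. assumption.
    + apply is_derive_scal. auto_derive; [lra | field; lra].
  - intros y Hy. assert (0 < y) by (apply Rlt_le_trans with (2 := proj1 Hy), Rmin_pos; lra).
    apply derivable_continuous_pt. eexists. apply is_derive_Reals. unfold G, Rpower.
    auto_derive; [split; [assumption | split; [lra | easy]] | reflexivity].
  - assert (Hy0 : 0 < y) by (apply Rlt_le_trans with (2 := proj1 Hy), Rmin_pos; lra).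
    assert (0 < / y ^ 2) by (apply Rinv_0_lt_compat, pow_lt, Hy0).
    assert (0 <= k y * (x - x0)).
    { destruct (Rle_lt_dec x0 x).
      - rewrite Rmin_left in Hy by lra. pose proof (Hmon x0 y ltac:(lra)). nra.
      - rewrite Rmax_left in Hy by lra. pose proof (Hmon y x0 ltac:(lra)). nra. }
    replace (alpha * k y / y ^ 2 * (x - x0)) with (alpha * / y ^ 2 * (k y * (x - x0))) in EG
      by (field; lra).
    assert (0 <= alpha * / y ^ 2 * (k y * (x - x0))); [| lra].
    apply Rmult_le_pos; [| assumption]. apply Rmult_le_pos; lra. }
apply Rle_trans with (2 := HG).
assert (H0 : 0 < x0 <= 1) by lra.
unfold k in E0. pose proof (Hle x0 H0) as [L1 _].
assert (EG : G x0 = (alpha + 1) * / x0 + (alpha - 1) * x0).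
{ unfold G. replace (A * Rpower x0 alpha) with ((1 - x0 ^ 2) / x0); [field; lra |].
  apply (Rmult_eq_reg_r x0); [| lra]. field_simplify; lra. }
rewrite EG.
set (B := sqrt (1 + A)).
assert (HB : 0 < B) by (apply sqrt_lt_R0; lra).
assert (HB2 : B * B = 1 + A) by (apply sqrt_sqrt; lra).
(* For x0 <= 1 and alpha <= 1 the power x0^alpha is at least x0, so the critical equation gives (1 +
   A) x0^2 <= 1. *)
assert (Hx1 : (B * x0) * (B * x0) <= 1).
{ replace (B * x0 * (B * x0)) with (B * B * x0 ^ 2) by ring. rewrite HB2.
  assert (0 <= A * x0 * (Rpower x0 alpha - x0)) by (apply Rmult_le_pos; nra). nra. }
assert (Hx2 : B * x0 <= 1) by nra.
assert (B <= / x0).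
{ apply (Rmult_le_reg_r x0); [lra |]. rewrite Rinv_l; lra. }
assert (x0 <= / B).
{ apply (Rmult_le_reg_r B); [lra |]. rewrite Rinv_l; lra. }
unfold Rdiv. nra.
Qed.

(** * The regions and the Cayley transform *)

Lemma Carg_polar (w : C) : w <> 0%C ->
  Re w = Cmod w * cos (Carg w) /\ Im w = Cmod w * sin (Carg w).
Proof.
intros Hw. destruct (proj1 (Carg_spec w (Carg w) Hw) eq_refl) as [_ E].
split; rewrite E at 1; unfold Cmult, RtoC; cbn [Re Im fst snd]; ring.
Qed.

(** For the strip, put x = s / |c|. The cross term of |i sigma s - c|^2 contributes -sigma n alpha
    tan t to the lower bound for [k], which is exactly what the centre of the strip cancels; what
    remains is n / (2 cos t) times the sum bounded by [weighted_sum_ge]. *)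
Lemma avoid_Omega (alpha : R) (c : C) (n : nat) (sigma s k : R) :
  0 < alpha <= 1 -> 0 < Re c -> (0 < n)%nat -> sigma = 1 \/ sigma = -1 -> 0 < s ->
  INR n * alpha * (Re c ^ 2 + (sigma * s - Im c) ^ 2) / (2 * Re c * s) <= k ->
  let t := Carg c in
  let A := 2 / INR n * Rpower (Cmod c) alpha * sin (PI * alpha / 2) * cos t in
  ~ Omega n alpha t A (Rpower s alpha * cos (PI * alpha / 2),
    sigma * (Rpower s alpha * sin (PI * alpha / 2) + k)).
Proof.
intros Ha Hc Hn Hsg Hs Hk t A.
pose proof PI_RGT_0 as HPI.
pose proof (lt_INR 0 n Hn) as HN. simpl in HN.
assert (Hc0 : c <> 0%C) by (intros ->; cbn in Hc; lra).
pose proof (proj1 (Cmod_gt_0 c) Hc0) as Hm.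
destruct (Carg_polar c Hc0) as [Ex Ey]. fold t in Ex, Ey.
assert (Hct : 0 < cos t) by nra.
assert (Hsin : 0 < sin (PI * alpha / 2)) by (apply sin_gt_0; nra).
assert (Hcos : 0 <= cos (PI * alpha / 2)) by (apply cos_ge_0; nra).
assert (Hrho : 0 < Rpower s alpha) by apply exp_pos.
assert (Hss : sigma * sigma = 1) by (destruct Hsg as [-> | ->]; ring).
assert (Hk0 : 0 <= k).
{ apply Rle_trans with (2 := Hk). apply Rdiv_le_0_compat; [| nra].
  apply Rmult_le_pos; [nra |]. pose proof (pow2_ge_0 (Re c)).
  pose proof (pow2_ge_0 (sigma * s - Im c)). lra. }
intros [H1 | [H2 | [H3 H4]]].
- unfold Omega1 in H1; cbn [Re fst] in H1. nra.
- unfold Omega2 in H2; cbn [Im snd] in H2. revert H2. apply Rle_not_lt.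
  pose (x := s / Cmod c). assert (Hx : 0 < x) by (apply Rdiv_lt_0_compat; assumption).
  assert (HA : 0 < A).
  { unfold A. assert (0 < 2 / INR n) by (apply Rdiv_lt_0_compat; lra).
    assert (0 < Rpower (Cmod c) alpha) by apply exp_pos.
    do 2 (apply Rmult_lt_0_compat; [| assumption]). apply Rmult_lt_0_compat; assumption. }
  assert (Hf : 0 < INR n / (2 * cos t)) by (apply Rdiv_lt_0_compat; lra).
  apply Rle_trans with
    (1 := Rmult_le_compat_l _ _ _ (Rlt_le _ _ Hf) (weighted_sum_ge alpha A x Ha HA Hx)).
  assert (Ep : Rpower s alpha = Rpower (Cmod c) alpha * Rpower x alpha).
  { rewrite Rpower_mult_distr by assumption. f_equal. unfold x. field. lra. }
  assert (E : INR n / (2 * cos t) * (A * Rpower x alpha + alpha * (x + / x))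
    = Rpower s alpha * sin (PI * alpha / 2)
      + INR n * alpha * (Re c ^ 2 + (sigma * s - Im c) ^ 2) / (2 * Re c * s)
      + sigma * (INR n * alpha * tan t)).
  { rewrite Ep. unfold A, x, tan. rewrite Ex, Ey.
    replace ((Cmod c * cos t) ^ 2 + (sigma * s - Cmod c * sin t) ^ 2)
      with (Cmod c ^ 2 * ((sin t)² + (cos t)²) + (sigma * sigma) * s ^ 2
        - 2 * sigma * s * Cmod c * sin t) by (unfold Rsqr; ring).
    rewrite sin2_cos2, Hss. field. repeat split; lra. }
  rewrite E.
  assert (Hab : forall r, sigma * r <= Rabs r).
  { intros r. pose proof (Rle_abs r). pose proof (Rle_abs (- r)) as H'.
    rewrite Rabs_Ropp in H'. destruct Hsg as [-> | ->]; lra. }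
  apply Rle_trans with (2 := Hab _).
  replace (sigma * (sigma * (Rpower s alpha * sin (PI * alpha / 2) + k) + INR n * alpha * tan t))
    with (sigma * sigma * (Rpower s alpha * sin (PI * alpha / 2) + k)
      + sigma * (INR n * alpha * tan t)) by ring.
  rewrite Hss. lra.
- set (w := (Rpower s alpha * cos (PI * alpha / 2),
    sigma * (Rpower s alpha * sin (PI * alpha / 2) + k)) : C) in *.
  pose proof (proj1 (Cmod_gt_0 w) H3) as Hw.
  destruct (Carg_polar w H3) as [E1 E2]. unfold w at 1 in E1. unfold w at 1 in E2. cbn [Re Im fst snd] in E1, E2.
  apply Rabs_lt_between in H4.
  (* Times |w|, this sine is the cross product of w, reflected when sigma = -1, with the upper edge
     ray. It equals -k cos (PI alpha / 2), which is not positive. *)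
  assert (Hd : 0 < sin (PI * alpha / 2 - sigma * Carg w))
    by (apply sin_gt_0; destruct Hsg as [-> | ->]; nra).
  rewrite sin_minus in Hd.
  assert (Es : sin (sigma * Carg w) = sigma * sin (Carg w)).
  { destruct Hsg as [-> | ->]; [rewrite !Rmult_1_l; reflexivity |].
    replace (-1 * Carg w) with (- Carg w) by ring. rewrite sin_neg. ring. }
  assert (Eo : cos (sigma * Carg w) = cos (Carg w)).
  { destruct Hsg as [-> | ->]; [rewrite !Rmult_1_l; reflexivity |].
    replace (-1 * Carg w) with (- Carg w) by ring. apply cos_neg. }
  rewrite Es, Eo in Hd.
  apply (Rmult_lt_compat_l (Cmod w)) in Hd; [| exact Hw].
  replace (Cmod w * (sin (PI * alpha / 2) * cos (Carg w) - cos (PI * alpha / 2) * (sigma * sin (Carg w))))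
    with (sin (PI * alpha / 2) * (Cmod w * cos (Carg w))
      - cos (PI * alpha / 2) * (sigma * (Cmod w * sin (Carg w)))) in Hd by ring.
  rewrite <- E1, <- E2 in Hd.
  replace (sigma * (sigma * (Rpower s alpha * sin (PI * alpha / 2) + k)))
    with (sigma * sigma * (Rpower s alpha * sin (PI * alpha / 2) + k)) in Hd by ring.
  rewrite Hss in Hd. nra.
Qed.

(** The principal power of exponent 1/alpha. It opens the sector to the right half-plane and is
    differentiable across the edges away from 0. *)
Definition Croot (alpha : R) (w : C) : C := Cexp (/ alpha * Clog w).

Definition cayley (c p : C) : C := ((p - c) * / (p + Cconj c))%C.

Lemma jet2_Croot (alpha : R) (w : C) : slit w ->
  jet2 (Croot alpha) w (Croot alpha w * (/ alpha * / w))%C.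
Proof.
intros Hw. apply (jet2_comp (fun w => / alpha * Clog w)%C Cexp); [| apply jet2_Cexp].
replace (/ alpha * / w)%C with (0 * Clog w + / alpha * / w)%C by ring.
apply (jet2_mult (fun _ => / alpha)%C Clog); [apply jet2_const | apply jet2_Clog, Hw].
Qed.

Lemma jet2_cayley (c p : C) : (p + Cconj c)%C <> 0%C ->
  jet2 (cayley c) p ((c + Cconj c) / ((p + Cconj c) * (p + Cconj c)))%C.
Proof.
intros Hp.
pose proof (jet2_plus _ _ _ _ _ (jet2_id p) (jet2_const (- c)%C p)) as J1.
pose proof (jet2_inv _ _ _ (jet2_plus _ _ _ _ _ (jet2_id p) (jet2_const (Cconj c) p)) Hp) as J2.
pose proof (jet2_mult _ _ _ _ _ J1 J2) as J. cbv beta in J.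
refine (eq_ind _ (jet2 (cayley c) p) J _ _). Cfield. exact Hp.
Qed.

Lemma plus_conj_neq_0 (c p : C) : 0 < Re c -> 0 <= Re p -> (p + Cconj c)%C <> 0%C.
Proof.
intros Hc Hp E. apply (f_equal Re) in E. destruct c as [x y], p as [a b].
unfold Cplus, Cconj, RtoC in E; cbn [Re fst snd] in *. lra.
Qed.

(** The reason is |p + conj c|^2 - |p - c|^2 = 4 Re c Re p, which also gives equality on the
    imaginary axis. *)
Lemma Cmod_cayley_le_1 (c p : C) : 0 < Re c -> 0 <= Re p -> Cmod (cayley c p) <= 1.
Proof.
intros Hc Hp. pose proof (plus_conj_neq_0 c p Hc Hp) as H0.
unfold cayley. rewrite Cmod_mult, Cmod_inv by exact H0.
apply Cmod_gt_0 in H0. apply Rle_div_l; [exact H0 |]. rewrite Rmult_1_l.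
apply Rsqr_incr_0; [| apply Cmod_ge_0 | lra].
rewrite !Rsqr_pow2, !Cmod2_alt. destruct c as [x y], p as [a b].
unfold Cminus, Cplus, Copp, Cconj; cbn [Re Im fst snd] in *. nra.
Qed.

Lemma Cmod_cayley_imaginary (c p : C) : 0 < Re c -> Re p = 0 -> Cmod (cayley c p) = 1.
Proof.
intros Hc Hp. pose proof (plus_conj_neq_0 c p Hc ltac:(lra)) as H0.
unfold cayley. rewrite Cmod_mult, Cmod_inv by exact H0.
apply Cmod_gt_0 in H0. replace (Cmod (p - c)) with (Cmod (p + Cconj c)); [field; lra |].
unfold Cmod. f_equal. destruct c as [x y], p as [a b].
unfold Cminus, Cplus, Copp, Cconj; cbn [Re Im fst snd] in *. subst a. ring.
Qed.

Lemma Re_Croot_pos (alpha : R) (w : C) : 0 < alpha <= 1 -> sector alpha w ->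
  0 < Re (Croot alpha w).
Proof.
intros Ha Hw. pose proof (sector_slit alpha w Ha Hw) as Hs.
apply (sector_Clog alpha w Hs) in Hw. apply Rabs_lt_between in Hw.
unfold Croot, Cexp. cbn [Re Im fst snd].
apply Rmult_lt_0_compat; [apply exp_pos |].
replace (Im (/ alpha * Clog w)) with (Im (Clog w) / alpha).
- pose proof (Rinv_0_lt_compat alpha (proj1 Ha)). pose proof PI_RGT_0.
  apply cos_gt_0.
  + apply Rlt_div_r; lra.
  + apply Rlt_div_l; lra.
- rewrite <- RtoC_inv by lra. destruct (Clog w) as [x y].
  unfold Cmult, RtoC; cbn [Im fst snd]. field. lra.
Qed.

(** Since |Im c| <= |c| < Re c + |c|, the tangent of half the argument lies strictly between -1 and
    1. *)
Lemma Im_Clog_right_half_plane (c : C) : 0 < Re c -> Rabs (Im (Clog c)) < PI / 2.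
Proof.
intros Hc. pose proof (im_le_Cmod c) as Hy. apply Rabs_le_between in Hy.
pose proof (Cmod_ge_0 c).
unfold Clog; cbn [Im snd].
assert (Hu : -1 < Im c / (Re c + Cmod c) < 1).
{ split; [apply Rlt_div_r | apply Rlt_div_l]; lra. }
apply Rabs_lt_between.
assert (- (PI / 4) < atan (Im c / (Re c + Cmod c)) < PI / 4); [| lra].
rewrite <- atan_1, <- atan_opp. split; apply atan_increasing; lra.
Qed.

Lemma Cpower_Cexp (c : C) (alpha : R) : slit c -> Cpower c alpha = Cexp (alpha * Clog c).
Proof.
intros Hc. unfold Cpower. rewrite (Carg_Clog c Hc).
unfold Cexp, Rpower. destruct (Clog c) as [x y] eqn:E.
assert (x = ln (Cmod c)) as -> by (unfold Clog in E; congruence).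
unfold Cmult, RtoC; cbn [Re Im fst snd].
rewrite !Rmult_0_l, !Rminus_0_r, !Rplus_0_r. reflexivity.
Qed.

Lemma Cpower_spec (c : C) (alpha : R) : 0 < alpha <= 1 -> 0 < Re c ->
  sector alpha (Cpower c alpha) /\ Croot alpha (Cpower c alpha) = c.
Proof.
intros Ha Hc. pose proof (Im_Clog_right_half_plane c Hc) as Hi.
assert (Hs : slit c) by (apply slit_Re_ge_0; [intros -> ; cbn in Hc |]; lra).
rewrite (Cpower_Cexp c alpha Hs).
assert (Ei : Im (alpha * Clog c) = alpha * Im (Clog c)).
{ destruct (Clog c) as [x y]. unfold Cmult, RtoC; cbn [Im fst snd]. ring. }
pose proof PI_RGT_0. apply Rabs_lt_between in Hi.
destruct (Clog_Cexp (alpha * Clog c)) as [S1 E1]; [rewrite Ei; nra |].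
split.
- apply sector_Clog; [exact S1 |]. rewrite E1, Ei. apply Rabs_lt_between. nra.
- unfold Croot. rewrite E1.
  assert (RtoC alpha <> 0%C) by (intros E; apply RtoC_inj in E; lra).
  replace (/ alpha * (alpha * Clog c))%C with (Clog c) by (field; assumption).
  apply Cexp_Clog, Hs.
Qed.

(** * The first exit from the sector *)

Lemma near_smaller_modulus (z0 : C) (P : C -> Prop) : z0 <> 0%C -> near z0 P ->
  exists w, Cmod w < Cmod z0 /\ P w.
Proof.
intros Hz HP. apply Cmod_gt_0 in Hz.
destruct (proj1 (near_Cmod _ _) HP) as [d Hd]. pose proof (cond_pos d).
set (s := Rmin (/ 2) (d / (2 * Cmod z0))).
assert (Hs : 0 < s /\ s <= / 2 /\ s <= d / (2 * Cmod z0)).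
{ split; [apply Rmin_pos; [lra |] | split; [apply Rmin_l | apply Rmin_r]].
  apply Rdiv_lt_0_compat; lra. }
destruct Hs as [S0 [S1 S2]]. apply Rle_div_r in S2; [| lra].
exists (z0 * (1 - s))%C. split.
- rewrite Cmod_mult, <- RtoC_minus, Cmod_R, Rabs_pos_eq by lra. nra.
- apply Hd. replace (z0 * (1 - s) - z0)%C with (z0 * - s)%C by ring.
  rewrite Cmod_mult, Cmod_opp, Cmod_R, Rabs_pos_eq by lra. lra.
Qed.

(** The sector is open and [q] continuous, so the bad points of modulus at most |z1| form a compact
    set, on which -|z| attains its maximum. *)
Lemma first_exit (alpha : R) (q : C -> C) (z1 : C) : 0 < alpha <= 1 ->
  (forall z, disk z -> Ccont q z) -> sector alpha (q 0%C) ->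
  disk z1 -> ~ sector alpha (q z1) ->
  exists z0, disk z0 /\ z0 <> 0%C /\ ~ sector alpha (q z0) /\
    forall w, Cmod w < Cmod z0 -> sector alpha (q w).
Proof.
intros Ha Hq H0 Hd1 Hz1.
destruct (attains_max (Cmod z1) (fun z => Cmod z <= Cmod z1 /\ ~ sector alpha (q z))
  (fun z => - Cmod z)) as [z0 [[Hz0 Hn0] Hmax]].
- intros z [H _]. exact H.
- intros z Hz. destruct (Rle_lt_dec (Cmod z) (Cmod z1)) as [Hle | Hlt].
  + assert (Hs : sector alpha (q z)) by (apply NNPP; intros H; apply Hz; auto).
    unfold disk in Hd1.
    pose proof (Hq z ltac:(unfold disk; lra) _ (near_sector alpha (q z) Ha Hs)) as H.
    unfold filtermap in H. revert H. apply filter_imp. intros w H [_ H']. contradiction.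
  + generalize (Rcont_gt (fun w => Cmod w) z _ (Rcont_Cmod _ _ (Ccont_id z)) Hlt).
    apply filter_imp. intros w H [H' _]. lra.
- exists z1. split; [lra | exact Hz1].
- intros z _. apply (continuous_opp (V:=R_NormedModule)). apply Rcont_Cmod, Ccont_id.
- unfold disk in *. exists z0. split; [lra | split; [| split; [exact Hn0 |]]].
  + intros ->. contradiction.
  + intros w Hw. apply NNPP. intros H.
    assert (Cmod w <= Cmod z1) by lra. pose proof (Hmax w ltac:(split; assumption)). lra.
Qed.

(** Approaching z0 from smaller moduli gives first Re q(z0) >= 0, which puts q(z0) in the slit plane
    where [Clog] is continuous, and then |arg| <= PI alpha / 2. Failure to lie in the sector gives
    the reverse inequality. *)
Lemma exit_argument (alpha : R) (q : C -> C) (z0 : C) : 0 < alpha <= 1 ->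
  Ccont q z0 -> z0 <> 0%C -> q z0 <> 0%C -> ~ sector alpha (q z0) ->
  (forall w, Cmod w < Cmod z0 -> sector alpha (q w)) ->
  slit (q z0) /\
  exists sigma, (sigma = 1 \/ sigma = -1) /\ Im (Clog (q z0)) = sigma * (PI * alpha / 2).
Proof.
intros Ha Hc Hz Hq Hn Hin.
assert (Hs : slit (q z0)).
{ apply slit_Re_ge_0; [exact Hq |]. apply Rnot_lt_le. intros Hlt.
  destruct (near_smaller_modulus z0 _ Hz (Rcont_lt _ z0 0 (Rcont_Re q z0 Hc) Hlt)) as [w [Hw H]].
  pose proof (sector_Re_pos alpha (q w) Ha (Hin w Hw)). lra. }
split; [exact Hs |].
assert (E : Rabs (Im (Clog (q z0))) = PI * alpha / 2).
{ apply Rle_antisym.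
  - apply Rnot_lt_le. intros Hlt.
    destruct (near_smaller_modulus z0 _ Hz (Rcont_gt (fun w => Rabs (Im (Clog (q w)))) z0 _
      (continuous_comp (V:=C_UniformSpace) q _ z0 Hc (Rcont_abs_Im_Clog _ Hs)) Hlt))
      as [w [Hw H]].
    pose proof (Hin w Hw) as Sw.
    apply (sector_Clog alpha (q w) (sector_slit alpha (q w) Ha Sw)) in Sw. lra.
  - apply Rnot_lt_le. intros Hlt. apply Hn, sector_Clog; assumption. }
rewrite <- E. unfold Rabs. destruct (Rcase_abs _).
- exists (-1). split; [right; reflexivity | ring].
- exists 1. split; [left; reflexivity | ring].
Qed.

Lemma jet2_lip (f : C -> C) (z a : C) : jet2 f z a ->
  exists L, 0 <= L /\ near z (fun w => Cmod (f w - f z) <= L * Cmod (w - z)).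
Proof.
intros [g [Hg Ej]].
assert (Hh : Ccont (fun w => a + (w - z) * g w)%C z) by ccont.
pose proof (Cmod_ge_0 (a + (z - z) * g z)).
exists (Cmod (a + (z - z) * g z) + 1). split; [lra |].
pose proof (Rcont_lt _ z (Cmod (a + (z - z) * g z) + 1) (Rcont_Cmod _ z Hh) ltac:(lra)) as Hn.
generalize (filter_and _ _ Ej Hn). apply filter_imp. intros w [E1 E2].
replace (f w - f z)%C with ((w - z) * (a + (w - z) * g w))%C by (rewrite E1; Cring).
rewrite Cmod_mult. pose proof (Cmod_ge_0 (w - z)). nra.
Qed.

Lemma polar_Clog (w : C) : slit w ->
  w = (Cmod w * cos (Im (Clog w)), Cmod w * sin (Im (Clog w))).
Proof.
intros Hs. pose proof (slit_neq_0 w Hs) as H0. rewrite <- (Carg_Clog w Hs).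
destruct (Carg_polar w H0) as [E1 E2]. rewrite <- E1, <- E2. apply surjective_pairing.
Qed.

Lemma Croot_at_edge (alpha sigma : R) (w : C) : 0 < alpha -> sigma = 1 \/ sigma = -1 ->
  slit w -> Im (Clog w) = sigma * (PI * alpha / 2) ->
  exists s, 0 < s /\ Croot alpha w = (0, sigma * s) /\
    w = (Rpower s alpha * cos (PI * alpha / 2), sigma * (Rpower s alpha * sin (PI * alpha / 2))).
Proof.
intros Ha Hsg Hs Hi. exists (exp (ln (Cmod w) / alpha)).
pose proof (proj1 (Cmod_gt_0 w) (slit_neq_0 w Hs)) as Hm.
split; [apply exp_pos | split].
- unfold Croot, Cexp.
  assert (E : (/ alpha * Clog w)%C = (ln (Cmod w) / alpha, sigma * (PI / 2))).
  { replace (Clog w) with (ln (Cmod w), sigma * (PI * alpha / 2))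
      by (rewrite <- Hi; symmetry; apply surjective_pairing).
    rewrite <- RtoC_inv by lra. unfold Cmult, RtoC; cbn [fst snd]. f_equal; field; lra. }
  rewrite E; cbn [Re Im fst snd].
  destruct Hsg as [-> | ->].
  + rewrite Rmult_1_l, cos_PI2, sin_PI2. f_equal; ring.
  + replace (-1 * (PI / 2)) with (- (PI / 2)) by ring.
    rewrite cos_neg, sin_neg, cos_PI2, sin_PI2. f_equal; ring.
- rewrite (polar_Clog w Hs) at 1. rewrite Hi.
  assert (E : Rpower (exp (ln (Cmod w) / alpha)) alpha = Cmod w).
  { unfold Rpower. rewrite ln_exp. replace (alpha * (ln (Cmod w) / alpha)) with (ln (Cmod w))
      by (field; lra). apply exp_ln, Hm. }
  rewrite E. destruct Hsg as [-> | ->].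
  + rewrite !Rmult_1_l. reflexivity.
  + replace (-1 * (PI * alpha / 2)) with (- (PI * alpha / 2)) by ring.
    rewrite cos_neg, sin_neg. f_equal; ring.
Qed.

Theorem corollary3p7 (alpha : R) (c : C) (n : nat) (q : C -> C) :
  0 < alpha <= 1 ->
  0 < Re c ->
  (0 < n)%nat ->
  Hclass (Cpower c alpha) n q ->
  let t := Carg c in
  let A := 2 / INR n * Rpower (Cmod c) alpha * sin (PI * alpha / 2) * cos t in
  (forall z : C, disk z ->
     q z <> 0%C /\
     Omega n alpha t A (q z + z * C_derive q z / q z)%C) ->
  forall z : C, disk z -> sector alpha (q z).
Proof.
intros Ha Hc Hn Hq t A HO z1 Hz1. apply NNPP. intros Hbad.
destruct (Hclass_sums_to _ _ _ Hq) as [b [Hb _]].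
destruct (Hclass_order _ _ _ Hn Hq) as [Q0 [K HK]].
destruct (Cpower_spec c alpha Ha Hc) as [Sq0 Rq0].
assert (Jq : forall z, disk z -> jet2 q z (C_derive q z)).
{ intros z Hz. destruct (sums_to_jet2 b q z Hb Hz) as [a Ja].
  rewrite (C_derive_jet2 q z a Ja). exact Ja. }
assert (Cq : forall z, disk z -> Ccont q z) by (intros z Hz; apply (jet2_cont _ _ _ (Jq z Hz))).
destruct (first_exit alpha q z1 Ha Cq ltac:(rewrite Q0; exact Sq0) Hz1 Hbad)
  as [z0 [Hd0 [Hz0 [Hn0 Hin]]]].
destruct (HO z0 Hd0) as [Hq0 HOm].
destruct (exit_argument alpha q z0 Ha (Cq z0 Hd0) Hz0 Hq0 Hn0 Hin) as [Hs0 [sigma [Hsg Hi]]].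
destruct (Croot_at_edge alpha sigma (q z0) (proj1 Ha) Hsg Hs0 Hi) as [s [Hs [Ep Eq]]].
pose (Phi := fun w => cayley c (Croot alpha w)).
assert (JPhi : forall w, slit w -> 0 <= Re (Croot alpha w) -> jet2 Phi w
  ((c + Cconj c) / ((Croot alpha w + Cconj c) * (Croot alpha w + Cconj c))
    * (Croot alpha w * (/ alpha * / w)))%C).
{ intros w Hw Hr. apply (jet2_comp (Croot alpha) (cayley c)); [apply jet2_Croot, Hw |].
  apply jet2_cayley, plus_conj_neq_0; assumption. }
assert (Jphi : forall z, disk z -> slit (q z) -> 0 <= Re (Croot alpha (q z)) ->
  jet2 (fun z => Phi (q z)) z
  ((c + Cconj c) / ((Croot alpha (q z) + Cconj c) * (Croot alpha (q z) + Cconj c))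
    * (Croot alpha (q z) * (/ alpha * / q z)) * C_derive q z)%C).
{ intros z Hz Hw Hr. apply (jet2_comp q Phi); [apply Jq, Hz | apply JPhi; assumption]. }
(* [Phi] vanishes at c^alpha and is Lipschitz there, so the bound O(|z|^n) for q - c^alpha passes to
   the composite without expanding it in powers of z. *)
assert (Hflat : exists L d, 0 < d /\
  forall z, Cmod z < d -> Cmod (Phi (q z)) <= L * Cmod z ^ n).
{ destruct (jet2_lip Phi _ _ (JPhi (Cpower c alpha) (sector_slit _ _ Ha Sq0)
    ltac:(rewrite Rq0; lra))) as [L [HL Hlip]].
  assert (E0 : Phi (Cpower c alpha) = 0%C) by (unfold Phi, cayley; rewrite Rq0; ring).
  rewrite E0 in Hlip. rewrite <- Q0 in Hlip at 1.
  pose proof (Cq 0%C disk_0 _ Hlip) as Hl. unfold filtermap in Hl.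
  destruct (proj1 (near_Cmod _ _) Hl) as [d Hd].
  exists (L * K), (Rmin d (/ 2)). split; [apply Rmin_pos; [apply cond_pos | lra] |].
  intros z Hz. pose proof (Rmin_l d (/ 2)). pose proof (Rmin_r d (/ 2)).
  pose proof (Hd z ltac:(replace (z - 0)%C with z by ring; lra)) as H1.
  replace (Phi (q z) - 0)%C with (Phi (q z)) in H1 by ring.
  pose proof (HK z ltac:(lra)) as H2. rewrite Rmult_assoc.
  apply Rle_trans with (1 := H1). apply Rmult_le_compat_l; [exact HL |]. exact H2. }
destruct Hflat as [L [d [Hd Hflat]]].
assert (Hin' : forall z, Cmod z < Cmod z0 ->
  disk z /\ slit (q z) /\ 0 <= Re (Croot alpha (q z))).
{ intros z Hz. unfold disk in *. pose proof (Hin z Hz) as Sz.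
  pose proof (Re_Croot_pos alpha (q z) Ha Sz).
  split; [lra | split; [apply (sector_slit alpha); assumption | lra]]. }
assert (Hr0 : Re (Croot alpha (q z0)) = 0) by (rewrite Ep; reflexivity).
destruct (jack (fun z => Phi (q z)) z0 _ n Hz0 Hn (Jphi z0 Hd0 Hs0 ltac:(lra))) as [Z1 Z2].
{ apply Cmod_cayley_imaginary; assumption. }
{ apply (schwarz (fun z => Phi (q z)) n (Cmod z0) L d Hn Hd); [| | exact Hflat].
  - intros z Hz. destruct (Hin' z Hz) as [D1 [D2 D3]]. eexists. apply Jphi; assumption.
  - intros z Hz. apply Cmod_cayley_le_1; [exact Hc | apply (Hin' z Hz)]. }
set (zeta := (z0 * ((c + Cconj c) / ((Croot alpha (q z0) + Cconj c) * (Croot alpha (q z0) + Cconj c))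
  * (Croot alpha (q z0) * (/ alpha * / q z0)) * C_derive q z0) / Phi (q z0))%C) in *.
pose proof (plus_conj_neq_0 c (Croot alpha (q z0)) Hc ltac:(lra)) as N1.
assert (N2 : Croot alpha (q z0) <> 0%C) by apply Cexp_neq_0.
assert (N3 : (Croot alpha (q z0) - c)%C <> 0%C).
{ intros E. apply (f_equal Re) in E. rewrite Ep in E. destruct c as [x y].
  unfold Cminus, Cplus, Copp, RtoC in E; cbn [Re fst snd] in *. lra. }
assert (N4 : RtoC alpha <> 0%C) by (intros E; apply RtoC_inj in E; lra).
assert (N5 : (c + Cconj c)%C <> 0%C) by (apply plus_conj_neq_0; lra).
(* With p the root of q, the chain rule gives zeta = (c + conj c) p / (alpha (p + conj c)(p - c))
   times z0 q'/q at z0; this is solved for the last factor. *)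
assert (Ek : (z0 * C_derive q z0 / q z0 = zeta * (alpha * ((Croot alpha (q z0) + Cconj c)
  * (Croot alpha (q z0) - c)) / ((c + Cconj c) * Croot alpha (q z0))))%C).
{ unfold zeta, Phi, cayley. field. repeat split; assumption. }
(* For purely imaginary p = i sigma s one has p + conj c = -conj (p - c), so (p + conj c)(p - c) =
   -|p - c|^2 and the cofactor of zeta is i sigma k. The factor n is absent from this [k]; it comes
   from Re zeta >= n. *)
pose (k := alpha * (Re c ^ 2 + (sigma * s - Im c) ^ 2) / (2 * Re c * s)).
assert (Es : (alpha * ((Croot alpha (q z0) + Cconj c) * (Croot alpha (q z0) - c))
  / ((c + Cconj c) * Croot alpha (q z0)))%C = (0, sigma * k)).
{ assert (E : (alpha * ((Croot alpha (q z0) + Cconj c) * (Croot alpha (q z0) - c)))%C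
    = ((0%R, (sigma * k)%R) * ((c + Cconj c) * Croot alpha (q z0)))%C).
  { rewrite Ep. unfold k. clear - Hc Hs Hsg. destruct c as [x y].
    unfold Cminus, Cplus, Copp, Cconj, Cmult, RtoC; cbn [Re Im fst snd] in *.
    destruct Hsg as [-> | ->]; f_equal; field; lra. }
  unfold Cdiv. rewrite E. field. split; assumption. }
assert (Hk : 0 <= k).
{ unfold k. apply Rdiv_le_0_compat; [| nra]. apply Rmult_le_pos; [lra |].
  pose proof (pow2_ge_0 (Re c)). pose proof (pow2_ge_0 (sigma * s - Im c)). lra. }
rewrite Ek, Es in HOm. revert HOm.
replace (q z0 + zeta * (0%R, (sigma * k)%R))%C with
  ((Rpower s alpha * cos (PI * alpha / 2),
    sigma * (Rpower s alpha * sin (PI * alpha / 2) + Re zeta * k)) : C).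
- apply avoid_Omega; try assumption.
  replace (INR n * alpha * (Re c ^ 2 + (sigma * s - Im c) ^ 2) / (2 * Re c * s))
    with (INR n * k) by (unfold k; field; lra).
  apply Rmult_le_compat_r; assumption.
- rewrite Eq. destruct zeta as [r i]. cbn [Im snd] in Z1. subst i.
  unfold Cplus, Cmult; cbn [Re Im fst snd]. f_equal; ring.
Qed.
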